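(* Let $\mu,\sigma,X,T,G,V,\mathcal{C},\mathcal{D},\mathbb{L}_X$ be as in the context. Assume: (i) $\mu$ and $\sigma$ are locally Lipschitz, $\mu$ is piecewise-$C^2$, $\sigma>0$ and $\sigma$ is piecewise-$C^3$; (ii) $G:[0,T]\times\mathbb{R}\to\mathbb{R}$ is upper semi-continuous; (iii) $V$ is continuous on $(0,T)\times\mathbb{R}$; (iv) there exists a free-boundary $\{b(t),\,0\le t\le T\}$ such that $\mathcal{C}=\{(t,x): t\in[0,T),\ x>b(t)\}$ and $\mathcal{D}=\{(t,x): t\in[0,T),\ x\le b(t)\}\cup(\{T\}\times\mathbb{R})$; (v) for any $t\in[0,T)$ there exist $\varepsilon>0$ and a ball $\mathcal{B}:=\mathcal{B}^{\varepsilon}_{t,b(t)}$ centered at $(t,b(t))$ with radius $\varepsilon$ such that $G\in C^{1,2}(\overline{\mathcal{B}\cap\mathcal{C}})$; (vi) there exist $\varepsilon>0$ and $\mathcal{B}$ as in (v) (for each $t\in[0,T)$) such that $G_{tx}$ and $G_{xxx}$ exist and are continuous in $\mathcal{B}\cap\mathcal{C}$, and moreover there exists a constant $\ell'_\varepsilon>0$ such that $$H_x:=\frac{\partial}{\partial x}\big(G_t+\mathbb{L}_XG\big)\ge\ell'_\varepsilon\quad\text{in }\overline{\mathcal{B}\cap\mathcal{C}}\qquad\text{and}\qquad V_x\ge G_x\quad\text{in }\mathcal{B}\cap\mathcal{C}.$$ Let $[t_1,t_2]\subset[0,T]$ be a time interval on which the free-boundary $b$ is decreasing. Then $t\mapsto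 b(t)$ is continuous on $[t_1,t_2]$.
   Context: Let $(\Omega,\mathcal{F},\mathsf{P})$ be a complete probability space with the natural filtration $\mathbb{F}=(\mathcal{F}_t)_{t\ge0}$ (completed with $\mathsf{P}$-null sets) of a one dimensional standard Brownian motion $B$. For $\mu:\mathbb{R}\to\mathbb{R}$ and $\sigma:\mathbb{R}\to\mathbb{R}_+$, $X=(X_t)_{t\ge0}$ is the real process that uniquely solves, in the strong sense, $dX_t=\mu(X_t)dt+\sigma(X_t)dB_t$, $X_0=x$. $\mathsf{P}_x$ is the probability measure induced by $X$ started at time zero from $x$, with expectation $\mathsf{E}_x$. Its infinitesimal generator is $\mathbb{L}_Xf(x)=\frac{\sigma^2(x)}{2}f''(x)+\mu(x)f'(x)$, acting on the space variable. Fix $0<T<\infty$ and $G:[0,T]\times\mathbb{R}\to\mathbb{R}$ (the gain function). The value function is $$V(t,x):=\sup_{0\le\tau\le T-t}\mathsf{E}_x\big[G(t+\tau,X_\tau)\big],$$ the supremum being over all $\mathbb{F}$-stopping times in $[0,T-t]$. The continuation set is $\mathcal{C}:=\{V>G\}$ and the stopping set is $\mathcal{D}:=\{V=G\}$. Standing assumptions: the stopping time $\tau_*(t,x):=\inf\{s\ge0: V(t+s,X_s)=G(t+s,X_s)\}\wedge(T-t)$ under $\mathsf{P}_x$ is optimal for $V(t,x)$; $\mathcal{C}$ is open and $\mathcal{D}$ is closed in $[0,T]\times\mathbb{R}$. By standard Markovian arguments $V\in C^{1,2}$ inside $\mathcal{C}$ and $V_t+\mathbb{L}_XV=0$ in $\mathcal{C}$.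 ''Decreasing'' on an interval means $b(s)\ge b(t)$ whenever $s\le t$ in the interval.
   Formalization: The value b(T), which appears in neither of the sets in (iv), is fixed by the convention that b(T) equals the left limit b(T−) whenever that limit exists; without this the claim fails at t_2=T, since b(T) could be lowered arbitrarily. *)

(* Defs.v *)
From HB Require Import structures.
From mathcomp Require Export all_boot all_order all_algebra.
From mathcomp Require Export all_classical all_reals all_analysis.
Set Implicit Arguments.
Unset Strict Implicit.
Unset Printing Implicit Defensive.
Export Order.TTheory GRing.Theory Num.Theory numFieldNormedType.Exports.
Local Open Scope classical_set_scope.
Local Open Scope ring_scope.

(* Time is indexed by R; only nonnegative times are ever used. *)

Section Processes.
Context {R : realType} {d : measure_display} {Omega : measurableType d}.
Implicit Types (P : probability Omega R) (Ft : R -> set (set Omega))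
  (B X : R -> Omega -> R) (xi tau : Omega -> R).

Definition random_in (S : set (set Omega)) (Y : Omega -> R) : Prop :=
  forall A : set R, measurable A -> S (Y @^-1` A).

Definition adapted Ft X : Prop := forall t, 0 <= t -> random_in (Ft t) (X t).

Definition continuous_paths X : Prop :=
  forall w, {within `[0, +oo[, continuous (fun t => X t w)}.

(* The inclusion of the P-negligible sets in Ft 0 forces P to be complete. *)
Definition complete_filtration P Ft : Prop :=
  [/\ forall t, 0 <= t -> sigma_algebra setT (Ft t),
      forall t, 0 <= t -> Ft t `<=` measurable,
      forall s t, 0 <= s -> s <= t -> Ft s `<=` Ft t
    & forall N, P.-negligible N -> Ft 0 N].

Definition natural_filtration P B (t : R) : set (set Omega) :=
  <<s [set A | exists2 u, 0 <= u <= t &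
                 preimage_set_system setT (B u) measurable A]
      `|` [set N | P.-negligible N] >>.

Definition brownian_motion P Ft B : Prop :=
  [/\ forall t, 0 <= t -> measurable_fun setT (B t),
      adapted Ft B, continuous_paths B, {ae P, forall w, B 0 w = 0}
    & forall s t, 0 <= s -> s < t ->
      forall (A : set Omega) (Y : set R), Ft s A -> measurable Y ->
        P (A `&` (fun w => B t w - B s w) @^-1` Y) =
        (P A * normal_prob 0 (Num.sqrt (t - s)) Y)%E].

(* I is the Ito integral of Z against B over [0, t], for an adapted integrand Z
   with continuous paths: the limit in probability of the left-endpoint sums
   along all subdivisions of [0, t] whose mesh tends to 0. *)
Definition ito_integral P (Z B : R -> Omega -> R) (t : R) (I : Omega -> R) :
    Prop :=
  forall e : R, 0 < e -> exists2 delta : R, 0 < delta &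
    forall s : seq R, itv_partition 0 t s ->
      (forall i, (i < size s)%N -> nth 0 s i - nth 0 (0 :: s) i < delta) ->
      (P [set w | e <= `| \sum_(i < size s) Z (nth 0 (0 :: s) i) w *
                            (B (nth 0 s i) w - B (nth 0 (0 :: s) i) w) - I w |]%R
        <= e%:E)%E.

(* X_t = xi + int_0^t mu(X_s) ds + int_0^t sigma(X_s) dB_s. *)
Definition sde_solution (mu sigma : R -> R) P Ft B xi X : Prop :=
  [/\ adapted Ft X, continuous_paths X, {ae P, forall w, X 0 w = xi w}
    & forall t, 0 <= t ->
      ito_integral P (fun s w => sigma (X s w)) B t
        (fun w => X t w - xi w
                  - \int[lebesgue_measure]_(s in `[0, t]) mu (X s w))].

Definition admissible Ft (m : R) tau : Prop :=
  (forall w, 0 <= tau w <= m) /\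
  (forall s, 0 <= s -> Ft s [set w | tau w <= s]).

(* X x is the process started from x.  Integrals whose positive and negative
   parts are both infinite are equal to -oo, hence do not affect the sup. *)
Definition gain P (X : R -> R -> Omega -> R) (G : R * R -> R) (p : R * R) tau :
    \bar R :=
  (\int[P]_w (G (p.1 + tau w, X p.2 (tau w) w))%:E)%E.

Definition value P Ft (X : R -> R -> Omega -> R) (T : R) (G : R * R -> R)
    (p : R * R) : \bar R :=
  ereal_sup [set gain P X G p tau | tau in admissible Ft (T - p.1)].

Definition tau_star (X : R -> R -> Omega -> R) (T : R) (G V : R * R -> R)
    (p : R * R) (w : Omega) : R :=
  inf ([set s | 0 <= s <= T - p.1 /\
                V (p.1 + s, X p.2 s w) = G (p.1 + s, X p.2 s w)]
       `|` [set T - p.1]).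

End Processes.

Section StrongSolutions.
Context {R : realType}.
Implicit Types (mu sigma : R -> R).

Definition cylinders : set (set (R -> R)) :=
  [set A | exists2 t : R, 0 <= t &
             preimage_set_system setT (fun w : R -> R => w t) measurable A].

(* F is a strong solution: a measurable functional of the initial value and of
   the driving path that yields a solution on every filtered space. *)
Definition strong_solution mu sigma (F : R -> (R -> R) -> R -> R) : Prop :=
  (forall t, 0 <= t ->
     measurable_fun setT (fun q : R * g_sigma_algebraType cylinders =>
                           F q.1 q.2 t)) /\
  (forall (d : measure_display) (Omega : measurableType d)
          (P : probability Omega R) (Ft : R -> set (set Omega))
          (B : R -> Omega -> R) (xi : Omega -> R),
     complete_filtration P Ft -> brownian_motion P Ft B ->
     random_in (Ft 0) xi ->
     sde_solution mu sigma P Ft B xi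
       (fun t w => F (xi w) (fun s => B s w) t)).

Definition pathwise_unique mu sigma : Prop :=
  forall (d : measure_display) (Omega : measurableType d)
         (P : probability Omega R) (Ft : R -> set (set Omega))
         (B : R -> Omega -> R) (xi : Omega -> R) (X Y : R -> Omega -> R),
    complete_filtration P Ft -> brownian_motion P Ft B ->
    random_in (Ft 0) xi ->
    sde_solution mu sigma P Ft B xi X -> sde_solution mu sigma P Ft B xi Y ->
    {ae P, forall w, forall t, 0 <= t -> X t w = Y t w}.

Definition unique_strong_solution mu sigma : Prop :=
  (exists F, strong_solution mu sigma F) /\ pathwise_unique mu sigma.

End StrongSolutions.

Section Calculus.
Context {R : realType}.
Implicit Types (f mu sigma : R -> R) (u : R * R -> R) (A : set (R * R)).

Definition locally_lipschitz f : Prop :=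
  forall x : R, exists2 U : set R, nbhs x U & [lipschitz f y | y in U].

(* Finitely many break points; off them f is C^k, and each derivative of order
   at most k has finite one-sided limits at them. *)
Definition piecewise_C (k : nat) f : Prop :=
  exists S : seq R,
    (forall x, x \notin S ->
       (forall j, (j < k)%N -> derivable (derive1n j f) x 1) /\
       {for x, continuous (derive1n k f)}) /\
    (forall x j, x \in S -> (j <= k)%N ->
       cvg (derive1n j f @ x^'-) /\ cvg (derive1n j f @ x^'+)).

(* Points of R * R are (time, space). *)
Definition dt u : R * R -> R := fun p => derive1 (fun s => u (s, p.2)) p.1.
Definition dx u : R * R -> R := fun p => derive1 (fun y => u (p.1, y)) p.2.

Definition derivable_t u (p : R * R) : Prop :=
  derivable (fun s => u (s, p.2)) p.1 1.
Definition derivable_x u (p : R * R) : Prop :=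
  derivable (fun y => u (p.1, y)) p.2 1.

(* The sets A of interest are relatively open in [0, T] * R, and may meet
   t = 0, where u has no two-sided time derivative; hence the interior of A. *)
Definition C12 A u : Prop :=
  forall p, A° p ->
    [/\ derivable_t u p, derivable_x u p & derivable_x (dx u) p] /\
    [/\ {for p, continuous u}, {for p, continuous (dt u)},
        {for p, continuous (dx u)} & {for p, continuous (dx (dx u))}].

Definition extends_to_closure A u : Prop :=
  exists g : R * R -> R,
    {within closure A, continuous g} /\ (forall p, A° p -> g p = u p).

Definition C12_closure A u : Prop :=
  [/\ C12 A u, {within closure A, continuous u}
    & [/\ extends_to_closure A (dt u), extends_to_closure A (dx u)
        & extends_to_closure A (dx (dx u))]].

Definition generator mu sigma u : R * R -> R := fun p =>
  sigma p.2 ^+ 2 / 2 * dx (dx u) p + mu p.2 * dx u p.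

Definition strip (T : R) : set (R * R) := [set p | 0 <= p.1 <= T].

Definition usc_on (E : set (R * R)) u : Prop :=
  forall p, E p -> forall a, u p < a ->
    \forall q \near within E (nbhs p), u q < a.

Definition disc (p : R * R) (e : R) : set (R * R) :=
  [set q | (q.1 - p.1) ^+ 2 + (q.2 - p.2) ^+ 2 < e ^+ 2].

Definition continuation_set (T : R) (G V : R * R -> R) : set (R * R) :=
  [set p | strip T p /\ G p < V p].

Definition stopping_set (T : R) (G V : R * R -> R) : set (R * R) :=
  [set p | strip T p /\ V p = G p].

End Calculus.

(* Main.v *)
(** Openness of the continuation set makes [b] upper semicontinuous, hence
    left-continuous where it decreases.  Suppose [b] jumps down to the right of
    [t], and put [u = V - G].  On a rectangle to the right of [t], between
    [b(t+)] and [b(t)] and free of break points of the coefficients, [u > 0],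
    [u_x >= 0] and [u_t + L u = - H].  The increment
    [Q(s, x, y) = u(s, y) - u(s, x)] is then nonnegative for [x <= y] and
    satisfies [Q_s + L_x Q + L_y Q = - (H(s, y) - H(s, x)) <= - ell (y - x)],
    so comparison with a quadratic barrier, by the minimum principle, bounds
    [Q], and hence [u], below by a constant [c > 0] uniformly as [s] decreases
    to [t].

    For [t > 0] this contradicts the continuity of [V] and [G], since [V = G] at
    time [t] below [b(t)].  At [t = 0] continuity of [V] is not assumed, and the
    contradiction comes from a better stopping rule: starting from [(0, x)], stop
    on leaving a small interval around [x] before a small time [s], and
    otherwise behave optimally from time [s] on.  By the Markov property at time
    [s] the expected gain is about [G(0, x) + c > V(0, x)].  The Markov property
    holds because [X_(s + .) = F(X_s, B_(s + .) - B_s)] for the strong solution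
    functional [F], by pathwise uniqueness. *)

From HB Require Import structures.
Require Import Defs.
From mathcomp Require Import measurable_realfun ring lra.
Set Implicit Arguments.
Unset Strict Implicit.
Unset Printing Implicit Defensive.
Local Open Scope classical_set_scope.
Local Open Scope ring_scope.

(** * Minimum principle *)

(** An increment in two space variables uses only derivatives that occur in the equation, and each
    variable keeps its own coefficients, so [mu] and [sigma] get differentiated only inside [H]. The
    equation runs backward in time: signs are needed on the late face and on the lateral faces of a
    box, none on the early face, where the bound is produced. This is why the bound reaches down to
    [t] although nothing is known about [u] there. At time zero the obstacles are measure-theoretic.
    [G] has no growth condition, so the Markov property is proved for nonnegative payoffs, applied
    to positive and negative parts separately, and a truncation event keeps the conditional
    expectations bounded. The filtration is not assumed right-continuous, so every rule is an
    entrance into a closed set along continuous paths, which is decided by the past alone. Since [F]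
    serves all driving motions, the Markov property reduces to two facts on Brownian motion: the
    increments after [s] are independent of the past and have the law of [B]. *)

Lemma derivable_is_derive1 (R : realType) (f : R -> R) (c : R) :
  derivable f c 1 -> is_derive c 1 f (derive1 f c).
Proof. by move=> df; rewrite derive1E; exact: derivableP. Qed.

Lemma derivable_right_quotient_cvg (R : realType) (f : R -> R) (c : R) :
  derivable f c 1 ->
  h^-1 *: (f (h + c) - f c) @[h --> 0^'+] --> derive1 f c.
Proof.
move=> df; apply: cvg_dnbhs_at_right; rewrite /derive1.
suff /cvg_ex[l lP] : cvg (h^-1 *: (f (h + c) - f c) @[h --> 0^']).
  by rewrite (cvg_lim _ lP).
move: df; rewrite /derivable.
by under eq_fun do rewrite /= scaler1.
Qed.

(** Meant for the time variable: the minimum over a box may sit on its early face, where only later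
    times can be compared. *)
Lemma derive1_ge0_right_min (R : realType) (f : R -> R) (c r : R) : 0 < r ->
  derivable f c 1 -> (forall x, c <= x < c + r -> f c <= f x) ->
  0 <= derive1 f c.
Proof.
move=> r0 /derivable_right_quotient_cvg df fmin.
rewrite -(cvg_lim _ df)//; apply: limr_ge; first by apply/cvg_ex; exists (derive1 f c).
near=> h.
have h0 : 0 < h by near: h; exact: nbhs_right_gt.
have hr : h < r by near: h; exact: nbhs_right_lt.
apply: mulr_ge0; first by rewrite invr_ge0 ltW.
by rewrite subr_ge0 fmin//; lra.
Unshelve. all: by end_near. Qed.

Lemma derive1_lt0_right (R : realType) (g : R -> R) (c : R) :
  derivable g c 1 -> g c = 0 -> derive1 g c < 0 ->
  exists2 r, 0 < r & forall x, c < x < c + r -> g x < 0.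
Proof.
move=> /derivable_right_quotient_cvg dg gc0 dg0.
have /nbhs_ballP[r/= r0 rP] : \forall h \near 0^'+, h^-1 *: (g (h + c) - g c) < 0.
  exact: (cvgr_lt _ dg).
exists r => // x /andP[cx xr].
have xc0 : 0 < x - c by lra.
have : (x - c)^-1 *: (g (x - c + c) - g c) < 0.
  by apply: rP => //; rewrite /ball/= sub0r normrN gtr0_norm//; lra.
by rewrite gc0 subr0 subrK pmulr_rlt0// invr_gt0.
Qed.

(** The second-order condition needs [derive1 f] to be derivable at [c] only: a negative second
    derivative makes [derive1 f] negative just to the right of [c], and the mean value theorem then
    produces a value below [f c]. *)
Lemma derive1_interior_min (R : realType) (f : R -> R) (a b c : R) :
  a < c < b ->
  (forall x, a < x < b -> derivable f x 1) -> derivable (derive1 f) c 1 ->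
  (forall x, a < x < b -> f c <= f x) ->
  derive1 f c = 0 /\ 0 <= derive1 (derive1 f) c.
Proof.
move=> /andP[ac cb] df ddf fmin.
have fc0 : derive1 f c = 0.
  rewrite derive1E; apply: derive_val.
  apply: (@derive1_at_min _ f a b c); first by lra.
  - by move=> t; rewrite in_itv => /=; exact: df.
  - by rewrite in_itv/= ac cb.
  - by move=> t; rewrite in_itv => /=; exact: fmin.
split => //; rewrite leNgt; apply/negP => ddf0.
have [r r0 rP] := derive1_lt0_right ddf fc0 ddf0.
pose x := c + Num.min r (b - c) / 2.
have [xc xr xb] : [/\ c < x, x < c + r & x < b].
  by rewrite /x; case: (ltP r (b - c)) => ?; split; lra.
have [y||d] := @MVT _ f (derive1 f) c x xc.
- rewrite in_itv/= => /andP[cy yx]; rewrite derive1E; apply: derivableP; apply: df; lra.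
- apply: derivable_within_continuous => y; rewrite in_itv/= => /andP[cy yx].
  by apply: df; lra.
- rewrite in_itv/= => /andP[cd dx] fE.
  have := fmin x; rewrite -subr_ge0 fE => H.
  have : derive1 f d * (x - c) < 0.
    by rewrite nmulr_rlt0; [lra|apply: rP; lra].
  by rewrite ltNge H//; lra.
Qed.

Lemma is_derive1_quadratic (R : realType) (v : R -> R) (v' A e k c z : R) :
  is_derive z 1 v v' ->
  is_derive z 1 (fun y => A + e * v y + k * (y - c) ^+ 2)
    (e * v' + 2 * k * (z - c)).
Proof.
move=> hv.
have hid := is_deriveB (is_derive_id z 1) (is_derive_cst c z 1).
have hq := is_deriveZ k (is_deriveX 2 hid).
have := is_deriveD (is_deriveD (is_derive_cst A z 1) (is_deriveZ e hv)) hq.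
have -> : e * v' + 2 * k * (z - c) = 0 + e * v' + k * (2 * (z - c) * (1 - 0)).
  by ring.
exact.
Qed.

(** Applied once in each space variable of the increment [u (s, y) - u (s, x)]: the sign [e] is [-1]
    in [x] and [1] in [y], and [k] is the curvature of the barrier. *)
Lemma quadratic_perturbation_min (R : realType) (v : R -> R)
    (A e k c a b z : R) : a < z < b ->
  (forall x, a < x < b -> derivable v x 1) -> derivable (derive1 v) z 1 ->
  (forall x, a < x < b ->
    A + e * v z + k * (z - c) ^+ 2 <= A + e * v x + k * (x - c) ^+ 2) ->
  e * derive1 v z + 2 * k * (z - c) = 0 /\
  0 <= e * derive1 (derive1 v) z + 2 * k.
Proof.
move=> azb dv ddv vmin.
pose f y := A + e * v y + k * (y - c) ^+ 2.
have fder x : a < x < b ->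
    is_derive x 1 f (e * derive1 v x + 2 * k * (x - c)).
  move=> axb; apply: is_derive1_quadratic; rewrite derive1E.
  by apply: derivableP; exact: dv.
have fderE x : a < x < b -> derive1 f x = e * derive1 v x + 2 * k * (x - c).
  by move=> axb; rewrite derive1E; have [] := fder x axb.
have hv2 : is_derive z 1 (derive1 v) (derive1 (derive1 v) z).
  by rewrite derive1E; exact: derivableP.
have hg : is_derive z 1 (fun y => e * derive1 v y + 2 * k * (y - c))
    (e * derive1 (derive1 v) z + 2 * k).
  have hid := is_deriveB (is_derive_id z 1) (is_derive_cst c z 1).
  have := is_deriveD (is_deriveZ e hv2) (is_deriveZ (2 * k) hid).
  have -> : e * derive1 (derive1 v) z + 2 * k =
    e * derive1 (derive1 v) z + 2 * k * (1 - 0) by rewrite subr0 mulr1.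
  exact.
have fg : {near z, (fun y => e * derive1 v y + 2 * k * (y - c)) =1 derive1 f}.
  near=> y; apply/esym/fderE; near: y.
  by case/andP: azb => az zb; near=> y; apply/andP; split; near: y;
    [exact: lt_nbhsr|exact: lt_nbhsl].
have [|||] := @derive1_interior_min _ f a b z azb.
- by move=> x axb; have [] := fder x axb.
- by apply: (near_eq_derivable fg); case: hg.
- exact: vmin.
rewrite fderE// => -> H; split => //.
move: H; rewrite derive1E -(near_eq_derive (1 : R^o) fg).
by have [_ ->] := hg.
Unshelve. all: by end_near. Qed.

(** Subtracting the two equations leaves the difference of [H] against four error terms. The
    second-order conditions bound each diffusion term by [2 k K], the first-order conditions bound
    each drift term by [2 k r K]; together they give [4 k K (1 + r)]. *)
Lemma parabolic_min_bound (R : realFieldType)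
    (ax ay mx my ux uy uxx uyy utx uty Hx Hy K k r l D M x xb y yb : R) :
  0 <= ax -> ax <= K -> 0 <= ay -> ay <= K -> `|mx| <= K -> `|my| <= K ->
  0 < k -> `|x - xb| <= r -> `|y - yb| <= r -> 0 < l -> D / 2 <= y - x ->
  0 <= uty - utx + M ->
  - 1 * ux + 2 * k * (x - xb) = 0 -> 0 <= - 1 * uxx + 2 * k ->
  1 * uy + 2 * k * (y - yb) = 0 -> 0 <= 1 * uyy + 2 * k ->
  utx + (ax * uxx + mx * ux) = - Hx -> uty + (ay * uyy + my * uy) = - Hy ->
  l * (y - x) <= Hy - Hx ->
  l * (D / 2) <= M + 4 * k * K * (1 + r).
Proof.
move=> ax0 axK ay0 ayK mxK myK k0 xr yr l0 Dxy ws wx wxx wy wyy px py hxy.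
have mul_le (p q P Q : R) : 0 <= p -> p <= P -> q <= Q -> 0 <= Q -> p * q <= P * Q.
  move=> p0 pP qQ Q0; apply: (@le_trans _ _ (p * Q)); first by rewrite ler_wpM2l.
  by rewrite ler_wpM2r.
have mul_abs (p q P Q : R) : `|p| <= P -> `|q| <= Q -> `|p * q| <= P * Q.
  by move=> pP qQ; rewrite normrM ler_pM.
have uxxle : uxx <= 2 * k by clear -wxx; lra.
have uyyle : - uyy <= 2 * k by clear -wyy; lra.
have k20 : 0 <= 2 * k by clear -k0; lra.
have e1 := mul_le _ _ _ _ ax0 axK uxxle k20.
have e2 := mul_le _ _ _ _ ay0 ayK uyyle k20.
have abs2 z z0 : `|z - z0| <= r -> `|2 * k * (z - z0)| <= 2 * k * r.
  by move=> ?; rewrite normrM (ger0_norm k20) ler_wpM2l.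
have uxE : ux = 2 * k * (x - xb) by clear -wx; lra.
have uyE : uy = - (2 * k * (y - yb)) by clear -wy; lra.
have := mul_abs _ _ _ _ mxK (abs2 _ _ xr); rewrite -uxE ler_norml => /andP[_ e3].
have : `|my * uy| <= K * (2 * k * r).
  by apply: mul_abs => //; rewrite uyE normrN; exact: abs2.
rewrite ler_norml => /andP[e4 _].
have e5 : l * (D / 2) <= l * (y - x) by rewrite ler_pM2l.
by clear -ws px py hxy e1 e2 e3 e4 e5; lra.
Qed.

(** The source term keeps pushing the increment up as time decreases, so it dominates a small
    barrier that vanishes at the late end and on the sides. Neither [c] nor [d'] depends on [s], and
    no condition is placed on [u] at time [t] itself: every box used starts at some [s0 > t]. *)
Lemma parabolic_spread_lower_bound (R : realType) (u H : R * R -> R)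
    (a m : R -> R) (t d xl xr l K xb yb : R) : 0 < d -> 0 < l -> 0 <= K ->
  (forall x, xl < x < xr -> [/\ 0 <= a x, a x <= K & `|m x| <= K]) ->
  (forall s x, t < s < t + d -> xl < x < xr ->
    [/\ derivable_t u (s, x), derivable_x u (s, x), derivable_x (dx u) (s, x),
        {for (s, x), continuous u} & 0 <= dx u (s, x)]) ->
  (forall s x, t < s < t + d -> xl < x < xr ->
    dt u (s, x) + (a x * dx (dx u) (s, x) + m x * dx u (s, x)) = - H (s, x)) ->
  (forall s x y, t < s < t + d -> xl < x -> x <= y -> y < xr ->
    l * (y - x) <= H (s, y) - H (s, x)) ->
  xl < xb -> xb < yb -> yb < xr ->
  exists2 c, 0 < c & exists2 d', 0 < d' <= d &
    forall s, t < s < t + d' -> c <= u (s, yb) - u (s, xb).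
Proof.
move=> d0 l0 K0 hcoef hu hpde hH xlb xyb ybr.
have umono s x y : t < s < t + d -> xl < x -> x <= y -> y < xr ->
    u (s, x) <= u (s, y).
  move=> st xx xy yx.
  apply: (@ger0_derive1_ndecr _ (fun z => u (s, z)) x y) => //.
  - by move=> z; rewrite in_itv/= => z1; have [] := hu s z st; first by lra.
  - by move=> z; rewrite in_itv/= => z1; have [] := hu s z st; first by lra.
  - apply: derivable_within_continuous => z; rewrite in_itv/= => z1.
    by have [] := hu s z st; first by lra.
pose D := yb - xb.
have DE : D = yb - xb by [].
have D0 : 0 < D by lra.
(* The bound [D / 4] keeps [y - x >= D / 2] on the whole box; the other two keep the closed box
   inside the open rectangle. *)
pose r := Num.min (D / 4) (Num.min ((xb - xl) / 2) ((xr - yb) / 2)).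
have [r0 rD rl rr] : [/\ 0 < r, r <= D / 4, r < xb - xl & r < xr - yb].
  have h1 : r <= D / 4 by rewrite /r ge_min lexx.
  have h2 : r <= (xb - xl) / 2 by rewrite /r !ge_min lexx/= orbT.
  have h3 : r <= (xr - yb) / 2 by rewrite /r !ge_min lexx/= !orbT.
  by split; [rewrite /r !lt_min; apply/and3P; split; lra|lra..].
(* Half of [d], so that the closed late face [t + d1] is still covered by the hypotheses. *)
pose d1 := d / 2.
have d1E : d1 = d / 2 by [].
have d10 : 0 < d1 by lra.
(* With [M] below, [k * (Z - 1)] is the right-hand side of [parabolic_min_bound], while
   [k * Z = l * D / 4] is less than its left-hand side [l * (D / 2)]. *)
pose Z := r ^+ 2 / d1 + 4 * K * (1 + r) + 1.
have Z0 : 0 < Z.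
  have : 0 <= r ^+ 2 / d1 by apply: divr_ge0; [exact: sqr_ge0|lra].
  have : 0 <= 4 * K * (1 + r) by apply: mulr_ge0; lra.
  by rewrite /Z; lra.
(* k is small enough for the barrier
   k (r^2 - (x - xb)^2 - (y - yb)^2) - M (s - t) to be a strict subsolution. *)
pose k := l * D / (4 * Z).
have k0 : 0 < k by rewrite /k divr_gt0// mulr_gt0//; lra.
(* The time term uses up the full height [k * r ^+ 2] of the barrier exactly at [t + d1], and at
   most half of it before [t + d1 / 2]. *)
pose M := k * r ^+ 2 / d1.
pose w (q : R * (R * R)) : R := u (q.1, q.2.2) - u (q.1, q.2.1)
  - k * (r ^+ 2 - (q.2.1 - xb) ^+ 2 - (q.2.2 - yb) ^+ 2) + M * (q.1 - t).
exists (k * r ^+ 2 / 2); first by rewrite divr_gt0// mulr_gt0// exprn_gt0.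
exists (d1 / 2); first by rewrite /d1; lra.
move=> s0 /andP[ts0 s0d].
pose B3 := `[s0, t + d1]%classic `*`
  (`[xb - r, xb + r]%classic `*` `[yb - r, yb + r]%classic).
have B3P q : B3 q <-> s0 <= q.1 <= t + d1 /\
    (xb - r <= q.2.1 <= xb + r /\ yb - r <= q.2.2 <= yb + r).
  by rewrite /B3/=; split; rewrite !in_itv/=.
have B3xy q : B3 q -> t < q.1 < t + d /\ [/\ xl < q.2.1 < xr, xl < q.2.2 < xr,
    xl < q.2.1, q.2.1 + D / 2 <= q.2.2 & q.2.2 < xr].
  by clear -rl rr rD DE d1E d10 ts0 B3P; move=> /B3P[? [? ?]]; split; [lra|split; lra].
have cB : compact B3.
  by apply: compact_setX; [exact: segment_compact|
    apply: compact_setX; exact: segment_compact].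
have wcont : {within B3, continuous w}.
  apply: continuous_in_subspaceT => q; rewrite inE => qB.
  have [q1 [qx qy _ _ _]] := B3xy _ qB.
  have [_ _ _ cx _] := hu _ _ q1 qx.
  have [_ _ _ cy _] := hu _ _ q1 qy.
  have c1 : {for q, continuous (fun q : R * (R * R) => q.1)} by exact: cvg_fst.
  have c21 : {for q, continuous (fun q : R * (R * R) => q.2.1)}.
    by apply: (continuous_comp (f := snd) (g := fst)); [exact: cvg_snd|exact: cvg_fst].
  have c22 : {for q, continuous (fun q : R * (R * R) => q.2.2)}.
    by apply: (continuous_comp (f := snd) (g := snd)); [exact: cvg_snd|exact: cvg_snd].
  have ux : u (p.1, p.2.1) @[p --> q] --> u (q.1, q.2.1).
    exact: (@cvg_comp _ _ _ (fun p : R * (R * R) => (p.1, p.2.1)) u _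
      (nbhs (q.1, q.2.1)) _ (cvg_pair c1 c21) cx).
  have uy : u (p.1, p.2.2) @[p --> q] --> u (q.1, q.2.2).
    exact: (@cvg_comp _ _ _ (fun p : R * (R * R) => (p.1, p.2.2)) u _
      (nbhs (q.1, q.2.2)) _ (cvg_pair c1 c22) cy).
  rewrite /continuous_at /w; apply: cvgD; last first.
    by apply: cvgM; [exact: cvg_cst|apply: cvgB => //; exact: cvg_cst].
  apply: cvgB; first exact: cvgB.
  apply: cvgM; first exact: cvg_cst.
  by apply: cvgB; [apply: cvgB; [exact: cvg_cst|]|];
    apply: cvgM; (apply: cvgB; [|exact: cvg_cst]).
have [|[s [x y]]] := @compact_EVT_min _ _ w B3 _ cB wcont.
  by exists (s0, (xb, yb)); apply/B3P => /=; lra.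
rewrite inE => sxyB wmin.
(* At the centre [(s0, (xb, yb))] the squares vanish, so [0 <= w] there leaves at least half of the
   height of the barrier. *)
suff w0 : 0 <= w (s, (x, y)).
  have : w (s, (x, y)) <= w (s0, (xb, yb)).
    by apply: wmin; rewrite inE; apply/B3P => /=; lra.
  move=> /(le_trans w0); rewrite /w/= !subrr expr0n/= !subr0.
  have : M * (s0 - t) <= k * r ^+ 2 / 2.
    have -> : k * r ^+ 2 / 2 = M * (d1 / 2) by rewrite /M; field; lra.
    rewrite ler_pM2l; first by lra.
    by rewrite /M divr_gt0// mulr_gt0// exprn_gt0.
  by lra.
rewrite leNgt; apply/negP => wneg.
have [/= sd [xx yy xlx xy yxr]] := B3xy _ sxyB.
have /B3P/=[sI [xI yI]] := sxyB.
have M0 : 0 < M by rewrite /M divr_gt0// mulr_gt0// exprn_gt0.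
have Q0 : 0 <= u (s, y) - u (s, x) by rewrite subr_ge0 umono//; lra.
have Md1 : M * d1 = k * r ^+ 2 by rewrite /M; field; lra.
have wneg' : u (s, y) - u (s, x)
  - k * (r ^+ 2 - (x - xb) ^+ 2 - (y - yb) ^+ 2) + M * (s - t) < 0 by [].
have sM : 0 < M * (s - t) by apply: mulr_gt0 => //; lra.
have sq1 : 0 <= k * (x - xb) ^+ 2 by apply: mulr_ge0; [lra|exact: sqr_ge0].
have sq2 : 0 <= k * (y - yb) ^+ 2 by apply: mulr_ge0; [lra|exact: sqr_ge0].
(* A negative minimum is off the late face and off the sides: there the barrier is nonpositive,
   whereas the increment is nonnegative by monotonicity of [u]. The early face [s = s0] remains
   possible. *)
have slt : s < t + d1.
  rewrite ltNge; apply/negP => sge.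
  have : M * d1 <= M * (s - t) by rewrite ler_pM2l//; lra.
  by rewrite Md1; lra.
have key z z0 : r <= `|z - z0| -> k * r ^+ 2 <= k * (z - z0) ^+ 2.
  move=> h; rewrite ler_pM2l// -(real_normK (num_real (z - z0))).
  by rewrite lerXn2r// ?nnegrE//; lra.
have xin : xb - r < x < xb + r.
  rewrite -ltr_distlC distrC ltNge; apply/negP => /key; lra.
have yin : yb - r < y < yb + r.
  rewrite -ltr_distlC distrC ltNge; apply/negP => /key; lra.
have [ut ux uxx _ _] := hu _ _ sd xx.
have [vt vx vxx _ _] := hu _ _ sd yy.
have ws : 0 <= dt u (s, y) - dt u (s, x) + M.
  pose f s' := u (s', y) - u (s', x) + M * s'.
  have [] : [/\ derivable f s 1
      & derive1 f s = dt u (s, y) - dt u (s, x) + M].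
    have hy : is_derive s 1 (fun s' => u (s', y)) (dt u (s, y)).
      exact: (derivable_is_derive1 vt).
    have hx : is_derive s 1 (fun s' => u (s', x)) (dt u (s, x)).
      exact: (derivable_is_derive1 ut).
    have : is_derive s 1 f (dt u (s, y) - dt u (s, x) + M).
      have := is_deriveD (is_deriveB hy hx) (is_deriveZ M (is_derive_id s 1)).
      have -> : dt u (s, y) - dt u (s, x) + M =
        dt u (s, y) - dt u (s, x) + M * 1 by rewrite mulr1.
      exact.
    by move=> hf; split; [case: hf|rewrite derive1E; exact: derive_val].
  move=> df <-; apply: (@derive1_ge0_right_min _ _ _ (t + d1 - s)) => //; first lra.
  move=> s' s's; have : w (s, (x, y)) <= w (s', (x, y)).
    by apply: wmin; rewrite inE; apply/B3P => /=; lra.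
  by rewrite /w/f/=; lra.
have [wx wxx] : - 1 * dx u (s, x) + 2 * k * (x - xb) = 0 /\
   0 <= - 1 * dx (dx u) (s, x) + 2 * k.
  have := @quadratic_perturbation_min _ (fun z => u (s, z)) 0 (-1) k xb
    (xb - r) (xb + r) x xin; apply; [|exact: uxx|].
    move=> z zr; have zx : xl < z < xr by lra.
    by have [_ uz _ _ _] := hu s z sd zx; exact: uz.
  move=> z zr; have : w (s, (x, y)) <= w (s, (z, y)).
    by apply: wmin; rewrite inE; apply/B3P => /=; lra.
  by rewrite /w/=; lra.
have [wy wyy] : 1 * dx u (s, y) + 2 * k * (y - yb) = 0 /\
   0 <= 1 * dx (dx u) (s, y) + 2 * k.
  have := @quadratic_perturbation_min _ (fun z => u (s, z)) 0 1 k yb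
    (yb - r) (yb + r) y yin; apply; [|exact: vxx|].
    move=> z zr; have zx : xl < z < xr by lra.
    by have [_ uz _ _ _] := hu s z sd zx; exact: uz.
  move=> z zr; have : w (s, (x, y)) <= w (s, (x, z)).
    by apply: wmin; rewrite inE; apply/B3P => /=; lra.
  by rewrite /w/=; lra.
have px := hpde _ _ sd xx.
have py := hpde _ _ sd yy.
have xley : x <= y by clear -xy D0; lra.
have hxy := hH _ _ _ sd xlx xley yxr.
have [ax0 axK mxK] := hcoef _ xx.
have [ay0 ayK myK] := hcoef _ yy.
have norm_lt z z0 : z0 - r < z < z0 + r -> `|z - z0| <= r.
  by clear; rewrite ler_norml; lra.
have Dle : D / 2 <= y - x by clear -xy; lra.
have := parabolic_min_bound ax0 axK ay0 ayK mxK myK k0 (norm_lt _ _ xin)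
  (norm_lt _ _ yin) l0 Dle ws wx wxx wy wyy px py hxy.
have kZ1 : k * (Z - 1) = M + 4 * k * K * (1 + r).
  by rewrite /Z/M; clear -d10; field; rewrite lt0r_neq0.
have kZ : k * Z = l * D / 4.
  by rewrite /k; clear -Z0; field; rewrite lt0r_neq0.
have lD : 0 < l * D by exact: mulr_gt0.
by clear -kZ1 kZ lD k0; lra.
Qed.

(** * Law of the shifted Brownian motion *)

(** The joint law of [(U, W)] agrees with a product measure on rectangles, hence everywhere, and
    Tonelli's theorem applies. That [Q] is the law of [W] is contained in the product formula, by
    taking [K1 = setT]. *)
Lemma integral_independent (R : realType) (d d1 d2 : measure_display)
    (Omega : measurableType d) (T1 : measurableType d1) (T2 : measurableType d2)
    (P : probability Omega R) (Q : probability T2 R)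
    (U : Omega -> T1) (W : Omega -> T2) (f : T1 * T2 -> \bar R) :
  measurable_fun setT U -> measurable_fun setT W ->
  (forall K1 K2, measurable K1 -> measurable K2 ->
    P (U @^-1` K1 `&` W @^-1` K2) = (P (U @^-1` K1) * Q K2)%E) ->
  measurable_fun setT f -> (forall x, 0 <= f x)%E ->
  (\int[P]_w f (U w, W w) = \int[P]_w \int[Q]_z f (U w, z))%E.
Proof.
move=> mU mW ind mf f0.
pose U' : {mfun Omega >-> T1} := HB.pack U (isMeasurableFun.Build _ _ _ _ _ mU).
have mUW : measurable_fun setT (fun w => (U w, W w)) by exact: measurable_fun_pair.
pose UW' : {mfun Omega >-> (T1 * T2)%type} :=
  HB.pack (fun w => (U w, W w)) (isMeasurableFun.Build _ _ _ _ _ mUW).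
transitivity (\int[distribution P UW']_z f z)%E.
  by rewrite ge0_integral_distribution.
transitivity (\int[distribution P U' \x Q]_z f z)%E.
  apply: eq_measure_integral => A mA _.
  apply: esym; apply: product_measure_unique => //.
rewrite fubini_tonelli1//.
have mF := measurable_fun_fubini_tonelli_F (m2 := Q) f mf f0.
by rewrite ge0_integral_distribution// => x; exact: integral_ge0.
Qed.

(** Filtrations are plain families of sets; this bridge makes the closure properties of measurable
    functions (sums, pairs, indicators) available relative to a single [Ft t]. *)
Lemma sub_sigma_algebra_measurable_fun (d d' : measure_display)
    (Omega : measurableType d) (T : measurableType d') (S : set (set Omega))
    (f : Omega -> T) : sigma_algebra setT S ->
  (forall K, measurable K -> S (f @^-1` K)) <->
  @measurable_fun _ _ (g_sigma_algebraType S) T setT f.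
Proof.
move=> sS; split=> [h _ K mK|h K mK].
  by rewrite setTI; apply: sub_sigma_algebra; exact: h.
have := h measurableT K mK; rewrite setTI /measurable/=.
by rewrite sigma_algebra_id.
Qed.

Lemma sigma_algebra_measurableE (d : measure_display) (Omega : measurableType d)
    (S : set (set Omega)) (A : set Omega) : sigma_algebra setT S ->
  S A <-> @measurable _ (g_sigma_algebraType S) A.
Proof. by move=> sS; rewrite /measurable/= sigma_algebra_id. Qed.

Lemma measure_eq_off_null (d : measure_display) (T : measurableType d)
    (R : realType) (m : {measure set T -> \bar R}) (N A C : set T) :
  measurable N -> measurable A -> measurable C -> m N = 0%E ->
  A `\` N = C `\` N -> m A = m C.
Proof.
move=> mN mA mC N0 ACN; rewrite (measureDI m mA mN) (measureDI m mC mN) ACN.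
have I0 D : measurable D -> m (D `&` N) = 0%E.
  by move=> mD; apply: (subset_measure0 _ _ _ N0) => //; exact: measurableI.
by congr (_ + _)%E; transitivity (0%E : \bar R); [|apply/esym]; exact: I0.
Qed.

(** * Finite-dimensional distributions of Brownian motion *)

Section BrownianCylinders.
Context {R : realType} {d : measure_display} {Omega : measurableType d}
  (P : probability Omega R) (Ft : R -> set (set Omega)) (B : R -> Omega -> R).
Hypothesis cF : complete_filtration P Ft.
Hypothesis bB : brownian_motion P Ft B.

Fixpoint path_cylinder (L : seq (R * set R)) (z : R -> R) : Prop :=
  if L is (t, Y) :: L' then Y (z t) /\ path_cylinder L' z else True.

(* Probability that x + W_{t - r} lies in Y for every (t, Y) in L, where W is a
   Brownian motion and the times in L are increasing and at least r. *)
Fixpoint cylinder_law (r : R) (L : seq (R * set R)) (x : R) : \bar R :=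
  if L is (t, Y) :: L' then
    if t == r then ((\1_Y x)%:E * cylinder_law t L' x)%E
    else (\int[normal_prob 0 (Num.sqrt (t - r))]_z
           ((\1_Y (x + z))%:E * cylinder_law t L' (x + z)))%E
  else 1%E.

Lemma cylinder_law_ge0 r L x : (0 <= cylinder_law r L x)%E.
Proof.
elim: L r x => [|[t Y] L IH] r x //=; case: ifP => _.
  by apply: mule_ge0 => //; rewrite lee_fin.
by apply: integral_ge0 => z _; apply: mule_ge0 => //; rewrite lee_fin.
Qed.

Lemma measurable_cylinder_law r L : (forall p, p \in L -> measurable p.2) ->
  measurable_fun setT (cylinder_law r L).
Proof.
elim: L r => [|[t Y] L IH] r mL //=.
have mY : measurable Y by apply: (mL (t, Y)); rewrite mem_head.
have mL' r' : measurable_fun setT (cylinder_law r' L).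
  by apply: IH => p pL; apply: mL; rewrite inE pL orbT.
have mg : measurable_fun setT (fun x => (\1_Y x)%:E * cylinder_law t L x)%E.
  by apply: emeasurable_funM => //; exact/measurable_EFinP/measurable_indic.
case: (t == r) => //.
pose f (p : R * R) := ((\1_Y (p.1 + p.2))%:E * cylinder_law t L (p.1 + p.2))%E.
apply: (measurable_fun_fubini_tonelli_F
  (m2 := normal_prob 0 (Num.sqrt (t - r))) f) => //.
  apply: (measurableT_comp (f := fun x => ((\1_Y x)%:E * cylinder_law t L x)%E)) => //.
  by apply: measurable_funD.
by move=> p; rewrite /f mule_ge0// ?lee_fin// cylinder_law_ge0.
Qed.

(** The induction closes because the past event and the starting position are both general: after
    the first time [t] of the list, the constraint [Y] is absorbed into the event, the increment
    into the position, and the motion restarts at [t]. *)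
Lemma brownian_cylinder_law s L (A : set Omega) (xi : Omega -> R) :
  0 <= s -> path <=%R s (map fst L) -> (forall p, p \in L -> measurable p.2) ->
  Ft s A -> random_in (Ft s) xi ->
  P (A `&` [set w | path_cylinder L (fun t => xi w + (B t w - B s w))]) =
  (\int[P]_w ((\1_A w)%:E * cylinder_law s L (xi w)))%E.
Proof.
have [sF Fm Fmono _] := cF.
have [mB aB _ _ iB] := bB.
elim: L s A xi => [|[t Y] L IH] s A xi s0 /= sL mL FA Fxi.
  have mA := Fm _ s0 _ FA.
  under eq_integral do rewrite mule1.
  by rewrite integral_indic// -setIA setTI setIT.
case/andP: sL => st tL.
have mY : measurable Y by apply: (mL (t, Y)); rewrite mem_head.
have mL' p : p \in L -> measurable p.2 by move=> pL; apply: mL; rewrite inE pL orbT.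
have t0 : 0 <= t by exact: le_trans st.
have sFt := sF _ t0.
have FtI A1 A2 : Ft t A1 -> Ft t A2 -> Ft t (A1 `&` A2).
  by rewrite !(sigma_algebra_measurableE _ sFt); exact: measurableI.
(* Intersecting cylinders may constrain one time twice, and the first time may be [s] itself. The
   increment is then zero, and the Gaussian law of increments is stated for [s < t] only. *)
have [tsE|ts] := eqVneq t s.
  subst t.
  have -> : (A `&` [set w | Y (xi w + (B s w - B s w)) /\
       path_cylinder L (fun t => xi w + (B t w - B s w))]) =
    ((A `&` xi @^-1` Y) `&` [set w | path_cylinder L (fun t => xi w + (B t w - B s w))]).
    by apply/seteqP; split => w /=; rewrite subrr addr0; tauto.
  rewrite IH//; last by apply: FtI => //; exact: Fxi.
  apply: eq_integral => w _; rewrite indicI/= EFinM muleA; congr (_ * _ * _)%E.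
have slt : s < t by rewrite lt_neqAle eq_sym ts.
pose xi' w := xi w + (B t w - B s w).
have mB' u : 0 <= u -> u <= t ->
    @measurable_fun _ _ (g_sigma_algebraType (Ft t)) R setT (B u).
  move=> u0 ut; apply/(sub_sigma_algebra_measurable_fun _ sFt) => K mK.
  by apply: (Fmono u) => //; exact: aB.
have Fxi' : random_in (Ft t) xi'.
  apply/(sub_sigma_algebra_measurable_fun _ sFt).
  apply: measurable_funD; last by apply: measurable_funB; apply: mB'.
  apply/(sub_sigma_algebra_measurable_fun _ sFt) => K mK.
  by apply: (Fmono s) => //; exact: Fxi.
have shiftE w : (fun u => xi' w + (B u w - B t w)) =
    (fun u => xi w + (B u w - B s w)) by apply/funext => u; rewrite /xi'; ring.
have -> : (A `&` [set w | Y (xi w + (B t w - B s w)) /\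
       path_cylinder L (fun t => xi w + (B t w - B s w))]) =
    ((A `&` xi' @^-1` Y) `&` [set w | path_cylinder L (fun u => xi' w + (B u w - B t w))]).
  by apply/seteqP; split => w /=; rewrite shiftE /xi'; tauto.
rewrite IH//; last first.
  by apply: FtI; [exact: (Fmono s)|exact: Fxi'].
have mA := Fm _ s0 _ FA.
have mxi : measurable_fun setT xi.
  by move=> _ K mK; rewrite setTI; apply: (Fm _ s0); exact: Fxi.
pose g (x : R) := ((\1_Y x)%:E * cylinder_law t L x)%E.
have mg : measurable_fun setT g.
  apply: emeasurable_funM; first exact/measurable_EFinP/measurable_indic.
  exact: measurable_cylinder_law.
have g0 x : (0 <= g x)%E by rewrite /g mule_ge0// ?lee_fin// cylinder_law_ge0.
(* The event [A] travels as the real coordinate [\1_A w], so that [U] gathers all information from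
   the past; the absolute value makes [f] nonnegative everywhere without changing it at such
   values. *)
pose f (p : (R * R) * R) := ((`|p.1.2|)%:E * g (p.1.1 + p.2)%R)%E.
pose U w := (xi w, \1_A w : R).
pose W w := B t w - B s w.
have sFs := sF _ s0.
have mUs : @measurable_fun _ _ (g_sigma_algebraType (Ft s)) (R * R)%type setT U.
  apply: measurable_fun_pair; first exact/(sub_sigma_algebra_measurable_fun _ sFs).
  by apply: measurable_indic; exact/(sigma_algebra_measurableE _ sFs).
transitivity (\int[P]_w f (U w, W w))%E.
  apply: eq_integral => w _; rewrite /f/U/W/= indicI/= EFinM -muleA ger0_norm//.
transitivity (\int[P]_w \int[normal_prob 0 (Num.sqrt (t - s))]_z f (U w, z))%E.
  apply: (integral_independent (P := P) (Q := normal_prob 0 (Num.sqrt (t - s)))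
    (U := U) (W := W) (f := f)) => //.
  - by apply: measurable_fun_pair => //; exact: measurable_indic.
  - by apply: measurable_funB; apply: mB.
  - move=> K1 K2 mK1 mK2; apply: iB => //.
    by move/(sub_sigma_algebra_measurable_fun _ sFs) : mUs; apply.
  - apply: emeasurable_funM.
      apply/measurable_EFinP; apply: measurableT_comp => //.
      by apply: measurableT_comp => //.
    apply: measurableT_comp => //; apply: measurable_funD => //.
    by apply: measurableT_comp => //.
  - by move=> p; rewrite /f mule_ge0// lee_fin.
apply: eq_integral => w _; rewrite /f/U/=.
under eq_integral do rewrite ger0_norm//.
rewrite ge0_integralZl//.
by apply: measurableT_comp => //; apply: measurable_funD.
Qed.

Lemma path_cylinder_perm L L' z : perm_eq L L' ->
  path_cylinder L z <-> path_cylinder L' z.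
Proof.
have E K : path_cylinder K z <-> (forall p, p \in K -> p.2 (z p.1)).
  elim: K => [|[t Y] K IH] /=; first by split.
  rewrite IH; split.
    by move=> [Yt h] p; rewrite inE => /predU1P[->//|]; exact: h.
  move=> h; split; first by apply: (h (t, Y)); rewrite mem_head.
  by move=> p pK; apply: h; rewrite inE pK orbT.
by move=> LL'; rewrite !E; split=> h p pL; apply: h; rewrite ?(perm_mem LL')//
  -(perm_mem LL').
Qed.

(** The factor [cylinder_law 0 L 0] mentions no motion, so any two Brownian motions agree on
    cylinders. As [B 0] vanishes only almost surely, the paths [B] and [B - B 0] are compared off a
    null set. *)
Lemma brownian_cylinder_prob L (A : set Omega) :
  path <=%R 0 (map fst L) -> (forall p, p \in L -> measurable p.2) -> Ft 0 A ->
  measurable [set w | path_cylinder L (B ^~ w)] /\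
  P (A `&` [set w | path_cylinder L (B ^~ w)]) = (P A * cylinder_law 0 L 0)%E.
Proof.
have [sF Fm Fmono _] := cF.
have [mB aB _ B0 iB] := bB.
move=> sL mL FA.
have mA := Fm _ (lexx 0) _ FA.
have tL0 t : t \in map fst L -> 0 <= t.
  by move: sL; rewrite path_sortedE; [move=> /andP[/allP h _]; exact: h|exact: le_trans].
have mcyl K (C : R -> Omega -> R) : {subset K <= L} ->
    (forall t, 0 <= t -> measurable_fun setT (C t)) ->
    measurable [set w | path_cylinder K (C ^~ w)].
  move=> + mC; elim: K => [|[t Y] K IH] KL /=.
    by rewrite (_ : [set _ | True] = setT)//; exact/seteqP.
  have -> : [set w | Y (C t w) /\ path_cylinder K (C ^~ w)] =
    (C t @^-1` Y) `&` [set w | path_cylinder K (C ^~ w)] by [].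
  have tYL : (t, Y) \in L by apply: KL; rewrite mem_head.
  apply: measurableI.
    rewrite -[X in measurable X]setTI; apply: mC => //; last exact: (mL (t, Y)).
    by apply: tL0; apply/mapP; exists (t, Y).
  by apply: IH => p pK; apply: KL; rewrite inE pK orbT.
split; first exact: mcyl.
have := @brownian_cylinder_law 0 L A (cst 0) (lexx _) sL mL FA.
rewrite (_ : (\int[P]_w _)%E = (P A * cylinder_law 0 L 0)%E); last first.
  transitivity (\int[P]_w (cylinder_law 0 L 0 * (\1_A w)%:E))%E.
    by apply: eq_integral => w _; rewrite muleC.
  have mIA : measurable_fun setT (fun w => (\1_A w)%:E : \bar R).
    exact/measurable_EFinP/measurable_indic.
  rewrite ge0_integralZl//; last exact: cylinder_law_ge0.
  by rewrite integral_indic// setIT muleC.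
have sF0 : sigma_algebra setT (Ft 0) by exact: sF.
have rc : random_in (Ft 0) (cst (0 : R)).
  move=> K mK; have [s00 sC _] := sF0; rewrite preimage_cst.
  by case: ifP => _ //; rewrite -(setD0 setT); exact: sC.
move=> /(_ rc) <-.
have [N [mN N0 NB]] := B0.
have NB' w : ~ N w -> B 0 w = 0 by move=> nN; apply: contrapT => h; apply: nN; exact: NB.
have mcyl0 : measurable [set w | path_cylinder L (fun t => 0 + (B t w - B 0 w))].
  apply: (mcyl L (fun t w => 0 + (B t w - B 0 w))) => // t t0.
  by apply: measurable_funD => //; apply: measurable_funB; apply: mB.
have cylE w : ~ N w -> (fun t => 0 + (B t w - B 0 w)) = B ^~ w.
  by move=> nN; apply/funext => t; rewrite NB'// subr0 add0r.
have mcylB := mcyl L B (fun=> id) mB.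
apply: (@measure_eq_off_null _ _ _ P N _ _ mN _ _ N0).
- exact: measurableI.
- exact: measurableI.
by apply/seteqP; split=> w /= [[Aw cw] nN]; (split => //; split => //); move: cw; rewrite cylE.
Qed.

End BrownianCylinders.

Section BrownianLaw.
Context {R : realType}.
Local Notation pathType := (g_sigma_algebraType (@cylinders R)).

Lemma measurable_fun_path (d : measure_display) (T : measurableType d)
    (Z : R -> T -> R) : (forall t, 0 <= t -> measurable_fun setT (Z t)) ->
  @measurable_fun _ _ T pathType setT (fun w => Z ^~ w).
Proof.
move=> mZ; apply: (@measurability _ _ T pathType setT _ (@cylinders R)); first by [].
move=> _ [_ [t t0 [Y mY <-]] <-]; rewrite !setTI.
rewrite -[X in measurable X]setTI; exact: mZ.
Qed.

(** One-time events generate the path sigma-algebra but are not stable under intersection; finite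
    cylinders are, as the Dynkin argument requires. *)
Let cylinder_system : set (set pathType) :=
  [set K | exists L : seq (R * set R),
    [/\ forall p, p \in L -> 0 <= p.1 /\ measurable p.2 & K = path_cylinder L]].

Let measurable_pathE : @measurable _ pathType = <<s cylinder_system >>.
Proof.
apply/seteqP; split.
  apply: sub_sigma_algebra2 => _ [t t0 [Y mY <-]].
  exists [:: (t, Y)]; split; first by move=> p; rewrite inE => /eqP ->.
  by rewrite setTI; apply/seteqP; split => z //= -[].
apply: smallest_sub; first exact: smallest_sigma_algebra.
move=> _ [L [hL ->]]; elim: L hL => [|[t Y] L IH] hL.
  by have -> : (path_cylinder [::] : set pathType) = setT by exact/seteqP.
have -> : (path_cylinder ((t, Y) :: L) : set pathType) =
  ((fun z : R -> R => z t) @^-1` Y) `&` path_cylinder L by [].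
have [/= t0 mY] := hL (t, Y) (mem_head _ _).
apply: (@measurableI _ pathType).
  by apply: sub_sigma_algebra; exists t => //; exists Y => //; rewrite setTI.
by apply: IH => p pL; apply: hL; rewrite inE pL orbT.
Qed.

Let cylinder_systemI : setI_closed cylinder_system.
Proof.
move=> _ _ [L1 [h1 ->]] [L2 [h2 ->]]; exists (L1 ++ L2); split.
  by move=> p; rewrite mem_cat => /orP[|]; [exact: h1|exact: h2].
have E z : path_cylinder (L1 ++ L2) z <-> path_cylinder L1 z /\ path_cylinder L2 z.
  by elim: L1 {h1} => [|[t Y] L IH] /=; [tauto|rewrite IH; tauto].
by apply/seteqP; split => z; rewrite E.
Qed.

(** Both sides are given by the same formula on cylinders, and the pi-lambda theorem extends the
    identity to path events. It is used with [B'] the increments after [s] and [Ft' 0] the past up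
    to [s]: it then contains both independence and equality in law. *)
Lemma brownian_law (d : measure_display) (Omega : measurableType d)
    (P : probability Omega R) (Ft Ft' : R -> set (set Omega))
    (B B' : R -> Omega -> R) (A : set Omega) (K : set pathType) :
  complete_filtration P Ft -> brownian_motion P Ft B ->
  complete_filtration P Ft' -> brownian_motion P Ft' B' ->
  Ft' 0 A -> measurable K ->
  P (A `&` [set w | K (B' ^~ w)]) = (P A * P [set w | K (B ^~ w)])%E.
Proof.
move=> cF bB cF' bB' FA.
have mA : measurable A by have [_ h _ _] := cF'; exact: (h 0).
have mpre (C : R -> Omega -> R) (H : set pathType) : (forall t, 0 <= t -> measurable_fun setT (C t)) ->
    measurable H -> measurable [set w | H (C ^~ w)].
  move=> mC mH; rewrite -[X in measurable X]setTI.
  exact: (measurable_fun_path mC) mH.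
have mB (H : set pathType) : measurable H -> measurable [set w | H (B ^~ w)].
  by apply: mpre; have [] := bB.
have mB' (H : set pathType) : measurable H -> measurable [set w | H (B' ^~ w)].
  by apply: mpre; have [] := bB'.
have PAfin : P A \is a fin_num by exact: fin_num_measure.
rewrite measurable_pathE; move: K.
apply: (dynkin_induction measurable_pathE cylinder_systemI).
- by rewrite (_ : [set _ | _] = setT)// setIT probability_setT mule1.
- move=> _ [L [hL ->]].
  pose leL := relpre (@fst R (set R)) <=%R.
  (* The iterated Gaussian formula requires increasing times, which an arbitrary cylinder does not
     have. *)
  pose L' := sort leL L.
  have LL' : perm_eq L L' by rewrite perm_sym perm_sort.
  have totL : total leL by move=> p q; exact: le_total.
  have sL' : path <=%R 0 (map fst L').
    rewrite path_sortedE; last exact: le_trans.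
    rewrite sorted_map sort_sorted// andbT.
    apply/allP => _ /mapP[p pL ->]; move: pL; rewrite mem_sort.
    by move=> /hL[].
  have mL' p : p \in L' -> measurable p.2 by rewrite mem_sort => /hL[].
  have E (C : R -> Omega -> R) :
      [set w | path_cylinder L (C ^~ w)] = [set w | path_cylinder L' (C ^~ w)].
    by apply/seteqP; split => w /=; rewrite (path_cylinder_perm _ LL').
  rewrite !E.
  have [_ ->] := brownian_cylinder_prob cF' bB' sL' mL' FA.
  have FT : Ft 0 setT.
    have [h _ _ _] := cF.
    by apply: (sigma_algebra_measurableE _ (h 0 (lexx 0))).2; exact: measurableT.
  have [_] := brownian_cylinder_prob cF bB sL' mL' FT.
  by rewrite setTI probability_setT mul1e => ->.
- move=> S mS IH.
  have -> : A `&` [set w | (~` S) (B' ^~ w)] = A `\` [set w | S (B' ^~ w)] by [].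
  have -> : [set w | (~` S) (B ^~ w)] = ~` [set w | S (B ^~ w)] by [].
  have mBS := mB _ mS; have mB'S := mB' _ mS.
  have Pfin : P [set w | S (B ^~ w)] \is a fin_num by exact: fin_num_measure.
  have PAlt : (P A < +oo)%E by rewrite ltey_eq PAfin.
  have E1 : P (A `\` [set w | S (B' ^~ w)]) =
    (P A - P (A `&` [set w | S (B' ^~ w)]))%E by exact: measureD.
  rewrite E1 IH (probability_setC _ mBS).
  rewrite -(fineK PAfin) -(fineK Pfin) -EFinM -!EFinB -EFinM.
  by congr EFin; ring.
- move=> F mF tF IH.
  have -> : A `&` [set w | (\bigcup_k F k) (B' ^~ w)] =
      \bigcup_k (A `&` [set w | F k (B' ^~ w)]).
    by apply/seteqP; split => w /=; [move=> [Aw [k _ Fk]]; exists k|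
      move=> [k _ [Aw Fk]]; split => //; exists k].
  have -> : [set w | (\bigcup_k F k) (B ^~ w)] =
      \bigcup_k [set w | F k (B ^~ w)] by [].
  have trivF (C : R -> Omega -> R) i j w : i != j -> F i (C ^~ w) -> F j (C ^~ w) -> False.
    move=> ij Fi Fj; have /trivIsetP/(_ i j Logic.I Logic.I ij)/seteqP[+ _] := tF.
    by move=> /(_ (C ^~ w)); apply.
  have S1 : P (\bigcup_k (A `&` [set w | F k (B' ^~ w)])) =
      (\sum_(0 <= k <oo) P (A `&` [set w | F k (B' ^~ w)]))%E.
    apply: measure_semi_bigcup.
    + by move=> i; apply: measurableI => //; exact: mB'.
    + apply/trivIsetP => i j _ _ ij; apply/seteqP; split => // w /= [[_ Fi] [_ Fj]].
      exact: (trivF B' i j w).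
    + by apply: bigcupT_measurable => i; apply: measurableI => //; exact: mB'.
  have S2 : P (\bigcup_k [set w | F k (B ^~ w)]) =
      (\sum_(0 <= k <oo) P [set w | F k (B ^~ w)])%E.
    apply: measure_semi_bigcup.
    + by move=> i; exact: mB.
    + apply/trivIsetP => i j _ _ ij; apply/seteqP; split => // w /= [Fi Fj].
      exact: (trivF B i j w).
    + by apply: bigcupT_measurable => i; exact: mB.
  rewrite S1 S2 -(fineK PAfin) -nneseriesZl; last by [].
  by apply: eq_eseriesr => i _; rewrite fineK//; exact: IH.
Qed.

End BrownianLaw.

(** * Continuous processes and the flow of the equation *)

Lemma continuous_halflineP (R : realType) (z : R -> R) :
  {within `[0, +oo[, continuous z} <->
  forall t, 0 <= t -> forall e, 0 < e -> exists2 del, 0 < del &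
    forall u, 0 <= u -> `|u - t| < del -> `|z u - z t| < e.
Proof.
have hl (x : R) : `[0, +oo[%classic x <-> 0 <= x by rewrite /= in_itv/= andbT.
split.
  move=> /subspace_continuousP zc t t0 e e0.
  have /cvgrPdist_lt/(_ e e0)/nbhs_ballP[del/= del0 hdel] := zc t ((hl t).2 t0).
  exists del => // u u0 utd; rewrite distrC; apply: hdel; last exact/hl.
  by rewrite /ball/= distrC.
move=> h; apply/subspace_continuousP => t /hl t0; apply/cvgrPdist_lt => e e0.
have [del del0 hdel] := h t t0 e e0.
apply/nbhs_ballP; exists del => //= u utd /hl u0.
by rewrite distrC; apply: hdel => //; rewrite distrC.
Qed.

Lemma measurable_fun_nat_index (d d' : measure_display) (T : measurableType d)
    (T' : measurableType d') (N : T -> nat) (h : nat -> T -> T') :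
  (forall k, measurable [set w | N w = k]) ->
  (forall k, measurable_fun setT (h k)) ->
  measurable_fun setT (fun w => h (N w) w).
Proof.
move=> mN mh _ Y mY; rewrite setTI.
have -> : (fun w => h (N w) w) @^-1` Y =
    \bigcup_k ([set w | N w = k] `&` h k @^-1` Y).
  apply/seteqP; split=> w /=; first by move=> Yw; exists (N w).
  by move=> [k _ [/= <-]].
apply: bigcupT_measurable => k; apply: measurableI => //.
by rewrite -[X in measurable X]setTI; exact: mh.
Qed.

(** Rounding [tau] up to the grid of mesh [1 / (n + 1)] leaves countably many values, so sampling is
    measurable piecewise; continuity of the paths passes to the limit. *)
Lemma measurable_fun_sample (R : realType) (d : measure_display)
    (T : measurableType d) (Z : R -> T -> R) (tau : T -> R) :
  (forall t, 0 <= t -> measurable_fun setT (Z t)) ->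
  (forall w, {within `[0, +oo[, continuous (Z ^~ w)}) ->
  measurable_fun setT tau -> (forall w, 0 <= tau w) ->
  measurable_fun setT (fun w => Z (tau w) w).
Proof.
move=> mZ cZ mtau tau0.
pose N n w := Num.truncn (n.+1%:R * tau w).
have Nitv n w : (N n w)%:R <= n.+1%:R * tau w < (N n w).+1%:R.
  by apply: truncn_itv; apply: mulr_ge0.
pose h n w := Z ((N n w).+1%:R / n.+1%:R) w.
apply: (@measurable_fun_cvg _ _ _ _ h).
  move=> n; apply: (@measurable_fun_nat_index _ _ _ _ (N n)
    (fun k w => Z (k.+1%:R / n.+1%:R) w)).
    move=> k.
    have -> : [set w | N n w = k] =
        (fun w => n.+1%:R * tau w) @^-1` `[k%:R, k.+1%:R[%classic.
      apply/seteqP; split => w /=; rewrite in_itv/=; first by move=> <-.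
      move=> /andP[k1 k2]; have /andP[n1 n2] := Nitv n w.
      have : (N n w < k.+1)%N by rewrite -(ltr_nat R); exact: le_lt_trans k2.
      have : (k < (N n w).+1)%N by rewrite -(ltr_nat R); exact: le_lt_trans n2.
      by rewrite !ltnS => a1 a2; apply/eqP; rewrite eqn_leq a1 a2.
    rewrite -[X in measurable X]setTI.
    by apply: measurable_funM => //.
  by move=> k; apply: mZ; apply: divr_ge0.
move=> w _; apply/cvgrPdist_lt => e e0.
have /continuous_halflineP/(_ _ (tau0 w) _ e0)[del del0 hdel] := cZ w.
near=> n.
rewrite distrC; apply: hdel; first by apply: divr_ge0.
have n0 : 0 < n.+1%:R :> R by [].
have nd : n.+1%:R^-1 < del by near: n; exact: near_infty_natSinv_lt (PosNum del0).
have /andP[n1 n2] := Nitv n w.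
have -> : (N n w).+1%:R / n.+1%:R - tau w = ((N n w).+1%:R - n.+1%:R * tau w) / n.+1%:R.
  by field; rewrite ?lt0r_neq0.
rewrite normrM normfV (gtr0_norm n0) gtr0_norm; last by lra.
apply: le_lt_trans nd; rewrite -[leRHS]mul1r ler_pM2r ?invr_gt0//.
by rewrite -natr1; lra.
Unshelve. all: by end_near. Qed.

(** Joint measurability in [(w, s)] is [measurable_fun_sample] with the running time [s] regarded as
    a random time on the product; Tonelli's theorem then handles positive and negative parts. *)
Lemma measurable_time_integral (R : realType) (d : measure_display)
    (T : measurableType d) (Z : R -> T -> R) (t : R) :
  (forall t, 0 <= t -> measurable_fun setT (Z t)) ->
  (forall w, {within `[0, +oo[, continuous (Z ^~ w)}) ->
  measurable_fun setT (fun w => \int[lebesgue_measure]_(s in `[0, t]) Z s w).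
Proof.
move=> mZ cZ.
(* [Z] is controlled at nonnegative times only; the maximum avoids the others, where the indicator
   vanishes anyway. *)
pose g (p : T * R) := Z (Num.max 0 p.2) p.1 * \1_`[0, t]%classic p.2.
have mg : measurable_fun setT g.
  apply: measurable_funM.
    apply: (@measurable_fun_sample _ _ _ (fun s (p : T * R) => Z s p.1) (fun p => Num.max 0 p.2)).
    - by move=> s s0; apply: measurableT_comp => //; exact: mZ.
    - by move=> p; exact: cZ.
    - by apply: measurable_maxr => //.
    - by move=> p; rewrite le_max lexx.
  by apply: measurableT_comp => //.
have E w : (\int[lebesgue_measure]_(s in `[0%R, t]) (Z s w)%:E =
    \int[lebesgue_measure]_s (EFin \o g) (w, s))%E.
  rewrite integral_mkcond; apply: eq_integral => s _; rewrite patchE /g/= indicE.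
  case: (boolP (s \in `[0, t]%classic)) => [|_]; last by rewrite mulr0.
  rewrite inE/= in_itv/= => /andP[s0 st]; rewrite mulr1.
  by rewrite (max_idPr s0).
rewrite /Rintegral; apply: (measurableT_comp (f := fine)) => //.
under eq_fun do rewrite E integralE.
have mEg : measurable_fun setT (EFin \o g) by exact/measurable_EFinP.
have h (f : T * R -> \bar R) : measurable_fun setT f -> (forall p, 0 <= f p)%E ->
    measurable_fun setT (fun w => \int[lebesgue_measure]_s f (w, s))%E.
  move=> mf f0.
  exact: (@measurable_fun_fubini_tonelli_F _ _ _ _ _ lebesgue_measure f mf f0).
apply: emeasurable_funB.
  apply: eq_measurable_fun (h _ (measurable_funepos mEg) (funepos_ge0 _)) => w _.
  by apply: eq_integral => s _; rewrite !funeposE.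
apply: eq_measurable_fun (h _ (measurable_funeneg mEg) (funeneg_ge0 _)) => w _.
by apply: eq_integral => s _; rewrite !funenegE.
Qed.

Lemma time_integral_shift (R : realType) (f : R -> R) (s t : R) :
  0 <= s -> 0 <= t -> {within `[0, +oo[, continuous f} ->
  \int[lebesgue_measure]_(r in `[0, s + t]) f r =
  \int[lebesgue_measure]_(r in `[0, s]) f r +
  \int[lebesgue_measure]_(r in `[0, t]) f (s + r).
Proof.
move=> s0 t0 fc.
have fcI a b : 0 <= a -> {within `[a, b], continuous f}.
  move=> a0; apply: continuous_subspaceW fc => x /=; rewrite !in_itv/= andbT.
  by move=> /andP[ax _]; exact: le_trans ax.
have fi a b : 0 <= a -> lebesgue_measure.-integrable `[a, b] (EFin \o f).
  by move=> a0; apply: continuous_compact_integrable; [exact: segment_compact|exact: fcI].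
have -> : \int[lebesgue_measure]_(r in `[0, t]) f (s + r) =
    \int[lebesgue_measure]_(r in `[s, s + t]) f r.
  have D1 : derive1 (fun r : R => s + r) = cst 1.
    apply/funext => x; rewrite derive1E.
    have -> : (fun r : R => s + r) = cst s + id by [].
    by rewrite deriveD// derive_cst derive_id add0r.
  have cs (x : R) : {for x, continuous (fun r : R => s + r)}.
    by apply: cvgD; [exact: cvg_cst|exact: cvg_id].
  rewrite /Rintegral; congr fine.
  have := @integration_by_substitution_increasing _ (fun r => s + r) f 0 t t0.
  rewrite addr0 D1 => ->.
  - by apply: eq_integral => x _; rewrite /GRing.mul/= mulr1.
  - by move=> x y _ _ xy; rewrite ltrD2l.
  - by move=> x _; exact: cvg_cst.
  - exact: is_cvg_cst.
  - exact: is_cvg_cst.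
  - split.
    + by move=> x _; apply: derivableD.
    + by apply: cvg_at_right_filter; exact: cs.
    + by apply: cvg_at_left_filter; exact: cs.
  - exact: fcI.
have := @Rintegral_itvB _ f (BLeft 0) (BRight (s + t)) s (fi _ _ (lexx 0)).
rewrite !bnd_simp => /(_ s0); rewrite lerDl => /(_ t0).
rewrite Rintegral_itv_obnd_cbnd; last first.
  apply: integrableS (fi 0 (s + t) (lexx 0)) => //.
  by apply: subset_itv; rewrite bnd_simp.
by move=> <-; ring.
Qed.

Lemma locally_lipschitz_continuous (R : realType) (f : R -> R) :
  locally_lipschitz f -> continuous f.
Proof.
move=> lf x; have [U Ux [M [_ hM]]] := lf x.
apply/cvgrPdist_lt => e e0.
(* The Lipschitz notation asserts the bound for all large enough constants; [M] is only the
   threshold, so a positive constant beyond it is chosen. *)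
pose K := `|M| + 1.
have K0 : 0 < K by rewrite /K; have := normr_ge0 M; lra.
have hK : forall p, (U `*` U) p -> `|f p.1 - f p.2| <= K * `|p.1 - p.2|.
  by move=> p Up; apply: (hM K) => //; rewrite /K; have := ler_norm M; lra.
near=> y.
have Uy : U y by near: y.
have Uxx : U x by exact: nbhs_singleton.
apply: (le_lt_trans (hK (x, y) (conj Uxx Uy))) => /=.
rewrite mulrC -ltr_pdivlMr//.
by near: y; apply: cvgr_dist_lt => //; exact: divr_gt0.
Unshelve. all: by end_near. Qed.

Lemma continuous_halfline_comp (R : realType) (f z : R -> R) :
  continuous f -> {within `[0, +oo[, continuous z} ->
  {within `[0, +oo[, continuous (f \o z)}.
Proof.
move=> cf /continuous_halflineP cz; apply/continuous_halflineP => t t0 e e0.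
have /cvgrPdist_lt/(_ e e0)/nbhs_ballP[eta/= eta0 heta] := cf (z t).
have [del del0 hdel] := cz t t0 eta eta0.
exists del => // u u0 ut; rewrite distrC; apply: heta.
by rewrite /ball/= distrC; exact: hdel.
Qed.

Section Filtration.
Context {R : realType} {d : measure_display} {Omega : measurableType d}
  (P : probability Omega R).

Lemma natural_filtration_complete (B : R -> Omega -> R) :
  measure_is_complete P ->
  (forall t, 0 <= t -> measurable_fun setT (B t)) ->
  complete_filtration P (natural_filtration P B).
Proof.
move=> cP mB; split.
- by move=> t t0; exact: smallest_sigma_algebra.
- move=> t t0; apply: smallest_sub; first exact: sigma_algebra_measurable.
  move=> A [[u /andP[u0 _] [Y mY <-]]|]; last exact: cP.
  exact: mB.
- move=> s t s0 st; apply: sub_sigma_algebra2 => A [[u /andP[u0 us] hu]|hA].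
    by left; exists u => //; rewrite u0 (le_trans us).
  by right.
- by move=> N hN; apply: sub_sigma_algebra; right.
Qed.

Variables (Ft : R -> set (set Omega)) (s : R).
Hypotheses (cF : complete_filtration P Ft) (s0 : 0 <= s).

Lemma complete_filtration_shift :
  complete_filtration P (fun r => Ft (s + r)).
Proof.
have [sF Fm Fmono Fn] := cF; split.
- by move=> t t0; apply: sF; exact: addr_ge0.
- by move=> t t0; apply: Fm; exact: addr_ge0.
- by move=> u t u0 ut; apply: Fmono; [exact: addr_ge0|rewrite lerD2l].
- by move=> N /Fn; apply: Fmono => //; rewrite addr0.
Qed.

Lemma continuous_paths_shift (X : R -> Omega -> R) :
  continuous_paths X -> continuous_paths (fun r => X (s + r)).
Proof.
move=> cX w; apply/continuous_halflineP => t t0 e e0.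
have /continuous_halflineP/(_ (s + t) (addr_ge0 s0 t0) e e0)[del del0 hdel] := cX w.
exists del => // u u0 utd; apply: hdel; first exact: addr_ge0.
by rewrite opprD addrACA subrr add0r.
Qed.

Lemma brownian_motion_shift (B : R -> Omega -> R) :
  brownian_motion P Ft B ->
  brownian_motion P (fun r => Ft (s + r)) (fun r w => B (s + r) w - B s w).
Proof.
have [sF Fm Fmono Fn] := cF.
move=> [mB aB cB B0 iB]; split.
- by move=> t t0; apply: measurable_funB; apply: mB => //; exact: addr_ge0.
- move=> t t0; have st0 := addr_ge0 s0 t0.
  apply/(sub_sigma_algebra_measurable_fun _ (sF _ st0)).
  apply: measurable_funB; apply/(sub_sigma_algebra_measurable_fun _ (sF _ st0)) => K mK.
    exact: aB.
  by apply: (Fmono s) => //; [rewrite lerDl|exact: aB].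
- move=> w; apply/continuous_halflineP => t t0 e e0.
  have hs : {within `[0, +oo[, continuous (fun r => B (s + r) w)}.
    exact: (continuous_paths_shift cB).
  have /continuous_halflineP/(_ t t0 e e0)[del del0 hdel] := hs.
  by exists del => // u u0 ut; rewrite opprB addrA subrK; exact: hdel.
- by exists set0; split => // w /=; rewrite addr0 subrr.
- move=> u t u0 ut A Y FA mY.
  have -> : (fun w => B (s + t) w - B s w - (B (s + u) w - B s w)) =
    (fun w => B (s + t) w - B (s + u) w) by apply/funext => w; ring.
  have -> : t - u = s + t - (s + u) by ring.
  by apply: iB => //; [exact: addr_ge0|rewrite ltrD2l].
Qed.

End Filtration.

(** * Left-endpoint sums and the equation restarted at a later time *)

Section LeftSums.
Context {R : realType}.
Implicit Types (a b s : R) (p q : seq R) (Z B : R -> R).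

Definition left_sum a p Z B : R :=
  \sum_(i < size p) Z (nth 0 (a :: p) i) * (B (nth 0 p i) - B (nth 0 (a :: p) i)).

Definition mesh_lt a p del : Prop :=
  forall i, (i < size p)%N -> nth 0 p i - nth 0 (a :: p) i < del.

Lemma left_sum_cons a c p Z B :
  left_sum a (c :: p) Z B = Z a * (B c - B a) + left_sum c p Z B.
Proof. by rewrite /left_sum big_ord_recl. Qed.

Lemma left_sum_cat a p q Z B :
  left_sum a (p ++ q) Z B = left_sum a p Z B + left_sum (last a p) q Z B.
Proof.
elim: p a => [|c p IH] a /=; first by rewrite {2}/left_sum big_ord0 add0r.
by rewrite !left_sum_cons IH addrA.
Qed.

Lemma left_sum_shift s p Z B : left_sum s (map (+%R s) p) Z B =
  left_sum 0 p (fun r => Z (s + r)) (fun r => B (s + r) - B s).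
Proof.
have {1}-> : s = s + 0 by rewrite addr0.
elim: p 0 => [|c p IH] a; first by rewrite /left_sum !big_ord0.
rewrite [map _ _]/= !left_sum_cons IH; congr (_ * _ + _); ring.
Qed.

Lemma mesh_lt_cons a c p del :
  mesh_lt a (c :: p) del <-> c - a < del /\ mesh_lt c p del.
Proof.
split=> [h|[ca h]]; first by split=> [|i ip]; [exact: (h 0%N)|exact: (h i.+1)].
by case=> [|i] ip //=; exact: h.
Qed.

Lemma mesh_lt_cat a p q del :
  mesh_lt a p del -> mesh_lt (last a p) q del -> mesh_lt a (p ++ q) del.
Proof.
elim: p a => [|c p IH] a //= /mesh_lt_cons[ca hp] hq.
by apply/mesh_lt_cons; split => //; exact: IH.
Qed.

Lemma mesh_lt_shift s p del : mesh_lt 0 p del -> mesh_lt s (map (+%R s) p) del.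
Proof.
have {1}-> : s = s + 0 by rewrite addr0.
elim: p 0 => [|c p IH] a; first by [].
move=> /mesh_lt_cons[ca hp]; apply/mesh_lt_cons; split; last exact: IH.
by rewrite opprD addrACA subrr add0r.
Qed.

Lemma itv_partition_mesh a b del : a <= b -> 0 < del ->
  exists2 p, itv_partition a b p & mesh_lt a p del.
Proof.
move=> ab del0.
have del2 : 0 < del / 2 by lra.
have [k hk] : exists k : nat, b - a <= k%:R * (del / 2).
  exists (Num.truncn ((b - a) / (del / 2))).+1; rewrite -ler_pdivrMr//.
  have : 0 <= (b - a) / (del / 2) by apply: divr_ge0; lra.
  by move=> /truncn_itv/andP[_ /ltW].
elim: k a ab hk => [|k IH] a ab hk.
  have ba : b = a by move: hk; rewrite mul0r; lra.
  by exists [::] => //; split => //=; rewrite ba.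
have [bsmall|blarge] := ltP (b - a) del.
  have [ba|ba] := eqVneq b a; first by exists [::] => //; split => //=; rewrite ba.
  exists [:: b]; first by split => //=; rewrite andbT lt_neqAle eq_sym ba.
  by apply/mesh_lt_cons.
have [||p [pa pl] pm] := IH (a + del / 2).
- by lra.
- by move: hk; rewrite -natr1 mulrDl mul1r; lra.
exists (a + del / 2 :: p); first by split => //=; rewrite pa andbT; lra.
by apply/mesh_lt_cons; split => //; lra.
Qed.

End LeftSums.

Section SdeShift.
Context {R : realType} {d : measure_display} {Omega : measurableType d}
  (P : probability Omega R) (Ft : R -> set (set Omega)) (B : R -> Omega -> R).
Hypotheses (cF : complete_filtration P Ft) (bB : brownian_motion P Ft B).

Lemma measurable_left_sum a p (Z : R -> Omega -> R) : path <%R a p -> 0 <= a ->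
  (forall t, 0 <= t -> measurable_fun setT (Z t)) ->
  measurable_fun setT (fun w => left_sum a p (Z ^~ w) (B ^~ w)).
Proof.
move=> + + mZ; have [mB _ _ _ _] := bB.
elim: p a => [|c p IH] a /=.
  by move=> _ _; rewrite /left_sum; under eq_fun do rewrite big_ord0; exact: measurable_cst.
move=> /andP[ac cp] a0.
have c0 : 0 <= c by rewrite (le_trans a0)// ltW.
under eq_fun do rewrite left_sum_cons.
apply: measurable_funD; last exact: IH.
by apply: measurable_funM; [exact: mZ|apply: measurable_funB; exact: mB].
Qed.

Lemma measurable_norm_ge (f : Omega -> R) e : measurable_fun setT f ->
  measurable [set w | e <= `|f w|].
Proof.
move=> mf.
have -> : [set w | e <= `|f w|] = (fun w => `|f w|) @^-1` `[e, +oo[%classic.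
  by apply/seteqP; split => w /=; rewrite in_itv/= andbT.
by rewrite -[X in measurable X]setTI; apply: measurableT_comp.
Qed.

(** The integral over [[s, s + t]] is handled as a difference: the shifted sum along [q] equals the
    sum along a partition of [[0, s + t]] minus the sum along one of [[0, s]]. Each is within
    [e / 2] of its integral outside an event of probability at most [e / 2]. *)
Lemma sde_solution_shift (mu sigma : R -> R) (X : R -> Omega -> R) (x s : R) :
  continuous mu -> continuous sigma -> 0 <= s ->
  sde_solution mu sigma P Ft B (fun=> x) X ->
  sde_solution mu sigma P (fun r => Ft (s + r))
    (fun r w => B (s + r) w - B s w) (X s) (fun r => X (s + r)).
Proof.
move=> cmu csigma s0 [aX cX X0 iX].
have [sF Fm Fmono Fn] := cF.
have [mB aB cB B0 iB] := bB.
have mX t : 0 <= t -> measurable_fun setT (X t).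
  by move=> t0 _ K mK; rewrite setTI; apply: (Fm t t0); exact: aX.
have mmuX t : 0 <= t -> measurable_fun setT (mu \o X t).
  by move=> t0; apply: measurableT_comp; [exact: continuous_measurable_fun|exact: mX].
have msX t : 0 <= t -> measurable_fun setT (sigma \o X t).
  by move=> t0; apply: measurableT_comp; [exact: continuous_measurable_fun|exact: mX].
have cmuX w : {within `[0, +oo[, continuous (fun t => mu (X t w))}.
  exact: (continuous_halfline_comp (z := X ^~ w)).
split.
- by move=> t t0; apply: aX; exact: addr_ge0.
- exact: continuous_paths_shift.
- by apply: aeW => w; rewrite addr0.
move=> t t0 e e0; have st0 := addr_ge0 s0 t0.
have e20 : 0 < e / 2 by lra.
have [d1 d10 h1] := iX _ st0 _ e20.
have [d2 d20 h2] := iX _ s0 _ e20.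
exists (Num.min d1 d2); first by rewrite lt_min d10.
move=> q [q1 /eqP q2] qm.
(* Any fine partition of [[0, s]] will do, since its contribution cancels in the difference. *)
have [p [p1 /eqP p2] pm] := itv_partition_mesh s0 (ltac:(by rewrite lt_min d10) : 0 < Num.min d1 d2).
pose pq := p ++ map (+%R s) q.
have pqP : itv_partition 0 (s + t) pq.
  split; last by rewrite /pq last_cat p2 -[X in last X _](addr0 s) last_map q2.
  rewrite /pq cat_path p1 p2/= -[X in path _ X _](addr0 s) path_map.
  by apply: sub_path q1 => a b /=; rewrite ltrD2l.
have pqm : mesh_lt 0 pq (Num.min d1 d2).
  by apply: mesh_lt_cat => //; rewrite p2; exact: mesh_lt_shift.
pose I u w := X u w - x - \int[lebesgue_measure]_(r in `[0, u]) mu (X r w).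
have mI u : 0 <= u -> measurable_fun setT (I u).
  move=> u0; apply: measurable_funB; first by apply: measurable_funB => //; exact: mX.
  by apply: (measurable_time_integral (Z := fun r w => mu (X r w))).
pose S a r w := left_sum a r (fun u => sigma (X u w)) (B ^~ w).
have mS r : path <%R 0 r -> measurable_fun setT (S 0 r).
  by move=> hr; apply: (measurable_left_sum (Z := fun u => sigma \o X u)).
pose E1 := [set w | e / 2 <= `|S 0 pq w - I (s + t) w|].
pose E2 := [set w | e / 2 <= `|S 0 p w - I s w|].
have mE1 : measurable E1.
  apply: measurable_norm_ge; apply: measurable_funB; last exact: mI.
  by apply: mS; case: pqP.
have mE2 : measurable E2.
  by apply: measurable_norm_ge; apply: measurable_funB; [exact: mS|exact: mI].
have PE1 : (P E1 <= (e / 2)%:E)%E.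
  apply: h1 => // i ip; apply: lt_le_trans (pqm i ip) _.
  by rewrite ge_min lexx.
have PE2 : (P E2 <= (e / 2)%:E)%E.
  apply: h2 => //; first by split => //; apply/eqP.
  by move=> i ip; apply: lt_le_trans (pm i ip) _; rewrite ge_min lexx orbT.
have SE w : S 0 pq w - I (s + t) w - (S 0 p w - I s w) =
    \sum_(i < size q) sigma (X (s + nth 0 (0 :: q) i) w) *
      (B (s + nth 0 q i) w - B s w - (B (s + nth 0 (0 :: q) i) w - B s w)) -
    (X (s + t) w - X s w - \int[lebesgue_measure]_(r in `[0, t]) mu (X (s + r) w)).
  rewrite /S/pq left_sum_cat p2 left_sum_shift /I (time_integral_shift s0 t0 (cmuX w)).
  by rewrite {2}/left_sum; ring.
have PU : (P (E1 `|` E2) <= e%:E)%E.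
  apply: (le_trans (measureU2 _ _ _)) => //.
  by apply: (le_trans (leeD PE1 PE2)); rewrite -EFinD lee_fin; lra.
apply: le_trans PU; apply: le_measure; rewrite ?inE.
- rewrite [X in measurable X](_ : _ = [set w | e <= `|S 0 pq w - I (s + t) w - (S 0 p w - I s w)|]).
    apply: measurable_norm_ge; apply: measurable_funB; apply: measurable_funB.
    + by apply: mS; case: pqP.
    + exact: mI.
    + exact: mS.
    + exact: mI.
  by apply/funext => w /=; rewrite SE.
- exact: measurableU.
move=> w /=; rewrite -SE => he.
have [w1|w1] := leP (e / 2) `|S 0 pq w - I (s + t) w|; first by left.
right; rewrite /E2/=.
have := ler_normB (S 0 pq w - I (s + t) w) (S 0 p w - I s w).
lra.
Qed.

End SdeShift.

(** * Entrance times *)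

Section PlaneTopology.
Context {R : realType}.

Lemma nbhs_planeP (p : R * R) (U : set (R * R)) : nbhs p U <->
  exists2 e, 0 < e & forall q, `|q.1 - p.1| < e -> `|q.2 - p.2| < e -> U q.
Proof.
split=> [/nbhs_ballP[e/= e0 he]|[e e0 he]].
  by exists e => // q q1 q2; apply: he; split; rewrite /ball/= distrC.
apply/nbhs_ballP; exists e => //= q [q1 q2]; apply: he.
  by rewrite distrC; exact: q1.
by rewrite distrC; exact: q2.
Qed.

(** The plane carries the product sigma-algebra, so an open set is exhibited as a countable union of
    boxes with rational centres and sizes. *)
Lemma open_plane_measurable (U : set (R * R)) : open U -> measurable U.
Proof.
move=> oU.
pose box (a b r : rat) : set (R * R) :=
  `]ratr a - ratr r, ratr a + ratr r[%classic `*`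
  `]ratr b - ratr r, ratr b + ratr r[%classic.
pose F a b r := if pselect (box a b r `<=` U) then box a b r else set0.
have -> : U = \bigcup_a \bigcup_b \bigcup_r F a b r.
  apply/seteqP; split=> [p Up|p [a _ [b _ [r _]]]]; last first.
    by rewrite /F; case: pselect => /= [bU bp|//]; exact: (bU p bp).
  have /nbhs_planeP[e e0 he] : nbhs p U by exact: open_nbhs_nbhs.
  have [r] : exists r, ratr r \in `]0, e / 2[ by apply: rat_in_itvoo; lra.
  rewrite in_itv/= => /andP[r0 re].
  have [a] : exists a, ratr a \in `]p.1 - ratr r, p.1 + ratr r[.
    by apply: rat_in_itvoo; lra.
  rewrite in_itv/= => /andP[a1 a2].
  have [b] : exists b, ratr b \in `]p.2 - ratr r, p.2 + ratr r[.
    by apply: rat_in_itvoo; lra.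
  rewrite in_itv/= => /andP[b1 b2].
  exists a => //; exists b => //; exists r => //; rewrite /F.
  case: pselect => /= [bU|nbU]; first by split; rewrite /= in_itv/=; apply/andP; split; lra.
  exfalso; apply: nbU => q [/=]; rewrite !in_itv/= => /andP[q1 q2] /andP[q3 q4].
  by apply: he; rewrite ltr_norml; apply/andP; split; lra.
do 3 (apply: bigcupT_measurable_rat => ?).
by rewrite /F; case: pselect => /= h //; exact: measurableX.
Qed.

Lemma usc_on_measurable (E : set (R * R)) (G : R * R -> R) :
  usc_on E G -> measurable E -> measurable_fun E G.
Proof.
move=> uscG mE; apply: (measurability _ (RGenInftyO.measurableE R)) => //.
move=> _ [_ [a ->] <-]; rewrite preimage_itvNyo.
pose U := \bigcup_(V in [set V : set (R * R) | open V /\ forall q, V q -> E q -> G q < a]) V.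
have oU : open U by apply: bigcup_open => V [].
have -> : E `&` [set x | G x < a] = E `&` U.
  apply/seteqP; split=> p [Ep /= pa]; split => //; last first.
    by case: pa => V [_ h] Vp; exact: h.
  have := uscG p Ep a pa; rewrite near_withinE/= nbhsE.
  by move=> [V [oV Vp] hV]; exists V => //; split => // q Vq Eq; exact: hV.
by apply: measurableI => //; exact: open_plane_measurable.
Qed.

Lemma closed_planeP (D : set (R * R)) (p : R * R) : closed D -> ~ D p ->
  exists2 e, 0 < e & forall q, `|q.1 - p.1| < e -> `|q.2 - p.2| < e -> ~ D q.
Proof.
move=> cD nDp; apply/nbhs_planeP.
by apply: open_nbhs_nbhs; split => //; exact: closed_openC.
Qed.

End PlaneTopology.

Section EntranceTime.
Context {R : realType}.
Implicit Types (D : set (R * R)) (m r : R) (z : R -> R).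

(** The set [D] lives in time-space and the horizon [m] belongs to the set under the infimum, as in
    [tau_star]; without an entrance the value is [m]. *)
Definition entrance_time D m z : R :=
  inf ([set q | 0 <= q <= m /\ D (q, z q)] `|` [set m]).

Definition hits D r z : Prop := exists2 q, 0 <= q <= r & D (q, z q).

Lemma entrance_time_itv D m z : 0 <= m -> 0 <= entrance_time D m z <= m.
Proof.
move=> m0; apply/andP; split.
  by apply: lb_le_inf; [exists m; right|move=> q [[/andP[q0 _] _]|->]].
by apply: ge_inf; [exists 0 => q [[/andP[q0 _] _]|->]|right].
Qed.

Variables (D : set (R * R)) (m : R) (z : R -> R).
Hypotheses (cD : closed D) (m0 : 0 <= m)
  (cz : {within `[0, +oo[, continuous z}).

Lemma avoid_neighborhood t : 0 <= t -> ~ D (t, z t) ->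
  exists2 e, 0 < e & forall u p, 0 <= u -> `|u - t| < e ->
    `|p.1 - u| < e -> `|p.2 - z u| < e -> ~ D p.
Proof.
move=> t0 /(closed_planeP cD)[e/= e0 he].
have e20 : 0 < e / 2 by lra.
have /continuous_halflineP/(_ t t0 _ e20)[del del0 hdel] := cz.
have mn0 : 0 < Num.min (e / 2) del by rewrite lt_min e20.
exists (Num.min (e / 2) del) => // u p u0; rewrite !lt_min.
move=> /andP[u1 u2] /andP[p1 _] /andP[p2 _].
have zu := hdel u u0 u2.
apply: he => /=.
  rewrite (_ : p.1 - t = (p.1 - u) + (u - t)); last by ring.
  by apply: le_lt_trans (ler_normD _ _) _; clear -p1 u1; lra.
rewrite (_ : p.2 - z t = (p.2 - z u) + (z u - z t)); last by ring.
by apply: le_lt_trans (ler_normD _ _) _; clear -p2 zu; lra.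
Qed.

Lemma entrance_time_hit : entrance_time D m z < m ->
  D (entrance_time D m z, z (entrance_time D m z)).
Proof.
have /andP[i0 im] := entrance_time_itv D z m0.
set i := entrance_time D m z in i0 im *.
move=> ilt; apply: contrapT => nD.
have [e e0 he] := avoid_neighborhood i0 nD.
have mn0 : 0 < Num.min e (m - i) by rewrite lt_min e0/=; lra.
pose K := [set q | 0 <= q <= m /\ D (q, z q)] `|` [set m].
have infK : has_inf K.
  by split; [exists m; right|exists 0 => q [[/andP[q0 _] _]|->]].
have [q Kq] := inf_adherent mn0 infK.
rewrite -/(entrance_time D m z) -/i => qi.
have iq : i <= q by apply: ge_inf; [case: infK|].
have := qi; rewrite -ltrBlDl lt_min => /andP[q1 q2].
case: Kq => [[/andP[q0 qm] Dq]|qm]; last by move: q2; rewrite qm; lra.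
by apply: (he q (q, z q)) => //=; rewrite ?subrr ?normr0// ger0_norm; lra.
Qed.

Lemma entrance_time_leP r : 0 <= r -> r < m ->
  entrance_time D m z <= r <-> hits D r z.
Proof.
move=> r0 rm; split=> [ir|[q /andP[q0 qr] Dq]].
  have /andP[i0 im] := entrance_time_itv D z m0.
  exists (entrance_time D m z); first by rewrite i0 ir.
  by apply: entrance_time_hit; exact: le_lt_trans rm.
apply: (le_trans _ qr); apply: ge_inf; first by exists 0 => u [[/andP[u0 _] _]|->].
by left; split => //; rewrite q0/= (le_trans qr)// ltW.
Qed.

(** Hitting a closed set becomes a countable condition: come arbitrarily close to it at grid times.
    The minimum with [r] keeps every sampled time in the past of [r], so that no right-continuity of
    the filtration is called for. *)
Lemma hits_approx r : 0 <= r -> hits D r z <->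
  forall n : nat, exists k j : nat, exists p : R * R, D p /\
    let q := Num.min r (k%:R / j.+1%:R) in
    `|p.1 - q| < n.+1%:R^-1 /\ `|p.2 - z q| < n.+1%:R^-1.
Proof.
move=> r0; split.
  move=> [q /andP[q0 qr] Dq] n.
  have n0 : 0 < n.+1%:R^-1 :> R by rewrite invr_gt0.
  have /continuous_halflineP/(_ q q0 _ n0)[del del0 hdel] := cz.
  have mn0 : 0 < Num.min del n.+1%:R^-1 by rewrite lt_min del0.
  have [j hj] : exists j : nat, j.+1%:R^-1 < Num.min del n.+1%:R^-1 :> R.
    have [j _ hj] := near_infty_natSinv_lt (PosNum mn0).
    by exists j; apply: (hj j) => /=.
  pose k := Num.truncn (j.+1%:R * q).
  have /andP[k1 k2] : k%:R <= j.+1%:R * q < k.+1%:R.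
    by apply: truncn_itv; apply: mulr_ge0.
  have j0 : 0 < j.+1%:R :> R by [].
  have kq : k%:R / j.+1%:R <= q by rewrite ler_pdivrMr// mulrC.
  have qk : q - k%:R / j.+1%:R < j.+1%:R^-1.
    rewrite -(ltr_pM2l j0) mulrBr mulfV ?lt0r_neq0// mulrCA mulfV ?lt0r_neq0// mulr1.
    by move: k2; rewrite -natr1; lra.
  exists k, j, (q, z q); split => //=.
  have -> : Num.min r (k%:R / j.+1%:R) = k%:R / j.+1%:R.
    by apply/min_idPr; exact: le_trans qr.
  have abs : `|q - k%:R / j.+1%:R| < Num.min del n.+1%:R^-1.
    by rewrite ger0_norm ?subr_ge0//; exact: lt_trans hj.
  move: abs; rewrite lt_min => /andP[a1 a2]; split => //.
  rewrite distrC; apply: hdel; first by apply: divr_ge0.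
  by rewrite distrC.
move=> h; apply: contrapT => nh.
have {}h (n : nat) : exists q : R, 0 <= q <= r /\ exists p : R * R, D p /\
    (`|p.1 - q| < n.+1%:R^-1 /\ `|p.2 - z q| < n.+1%:R^-1).
  have [k [j [p hp]]] := h n; exists (Num.min r (k%:R / j.+1%:R)); split.
    by rewrite ge_min lexx le_min r0/= divr_ge0.
  by exists p.
have [q hq] := choice h.
have Fq : ProperFilter (q @ \oo) by exact: fmap_proper_filter.
(* Compactness yields a cluster time of the near misses; a path avoiding [D] there would keep a
   positive distance from it nearby. *)
have [t [/=]] : `[0, r]%classic `&` cluster (q @ \oo) !=set0.
  apply: (@segment_compact _ 0 r) => //.
  by exists 0%N => // n _ /=; rewrite in_itv/=; case: (hq n).
rewrite in_itv/= => /andP[t0 tr] clt.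
have nD : ~ D (t, z t) by move=> Dt; apply: nh; exists t => //; rewrite t0.
have [e e0 he] := avoid_neighborhood t0 nD.
have : nbhs t [set u | `|u - t| < e].
  by apply/nbhs_ballP; exists e => //= u; rewrite /ball/= distrC.
have : (q @ \oo) [set u | 0 <= u /\ exists p, D p /\ (`|p.1 - u| < e /\ `|p.2 - z u| < e)].
  have [N _ hN] := near_infty_natSinv_lt (PosNum e0).
  exists N => // n Nn /=; have [/andP[q0 _] [p [Dp [p1 p2]]]] := hq n.
  split => //; exists p; split => //.
  by split; [apply: lt_trans p1 _|apply: lt_trans p2 _]; exact: (hN n Nn).
move=> /clt h1 /h1[u [[u0 [p [Dp [p1 p2]]]] ut]].
exact: (he u p).
Qed.

End EntranceTime.

Section EntranceMeasurable.
Context {R : realType} {d : measure_display} {T : measurableType d}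
  (Z : R -> T -> R).
Hypothesis cZ : forall w, {within `[0, +oo[, continuous (Z ^~ w)}.

(** Measurability of [Z] is asked up to time [r] only, so the lemma applies to the sigma-algebra
    [Ft r] of an adapted process. *)
Lemma measurable_hits (D : set (R * R)) (r : R) : closed D -> 0 <= r ->
  (forall q, 0 <= q <= r -> measurable_fun setT (Z q)) ->
  measurable [set w | hits D r (Z ^~ w)].
Proof.
move=> cD r0 mZ.
pose q k j : R := Num.min r (k%:R / j.+1%:R).
pose O n k j : set R := \bigcup_(p in [set p | D p /\ `|p.1 - q k j| < n.+1%:R^-1])
  [set y | `|p.2 - y| < n.+1%:R^-1].
have -> : [set w | hits D r (Z ^~ w)] =
    \bigcap_n \bigcup_k \bigcup_j (Z (q k j) @^-1` O n k j).
  apply/seteqP; split=> w /=.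
    move=> /(hits_approx cD (@cZ w) r0) h n _.
    by have [k [j [p [Dp [p1 p2]]]]] := h n; exists k => //; exists j => //; exists p.
  move=> h; apply/(hits_approx cD (@cZ w) r0) => n.
  by have [k _ [j _ [p [Dp p1] p2]]] := h n Logic.I; exists k, j, p.
apply: bigcapT_measurable => n; apply: bigcupT_measurable => k.
apply: bigcupT_measurable => j.
rewrite -[X in measurable X]setTI; apply: mZ => //.
  by rewrite /q le_min r0 ge_min lexx divr_ge0.
apply: open_measurable; apply: bigcup_open => p _.
by have := @ball_open _ R p.2 n.+1%:R^-1; apply; rewrite invr_gt0.
Qed.

Lemma measurable_entrance_time (D : set (R * R)) (m : R) : closed D -> 0 <= m ->
  (forall q, 0 <= q -> measurable_fun setT (Z q)) ->
  measurable_fun setT (fun w => entrance_time D m (Z ^~ w)).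
Proof.
move=> cD m0 mZ; apply: (measurability _ (RGenOInfty.measurableE R)) => //.
move=> _ [_ [r ->] <-]; rewrite preimage_itvoy setTI.
have -> : [set w | r < entrance_time D m (Z ^~ w)] =
    ~` [set w | entrance_time D m (Z ^~ w) <= r].
  by apply/seteqP; split => w /=; rewrite ltNge => /negP.
apply: measurableC.
have [rm|mr] := ltP r m; last first.
  rewrite (_ : [set _ | _] = setT)//; apply/seteqP; split => // w _ /=.
  by have /andP[_ im] := entrance_time_itv D (Z ^~ w) m0; exact: le_trans mr.
have [r0|r0] := leP 0 r; last first.
  rewrite (_ : [set _ | _] = set0)//; apply/seteqP; split => // w /= h.
  have /andP[i0 _] := entrance_time_itv D (Z ^~ w) m0.
  by have := le_lt_trans h r0; rewrite ltNge i0.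
rewrite (_ : [set _ | _] = [set w | hits D r (Z ^~ w)]).
  by apply: measurable_hits => // q /andP[q0 _]; exact: mZ.
by apply/seteqP; split=> w /=; rewrite (entrance_time_leP cD m0 (@cZ w) r0 rm).
Qed.

End EntranceMeasurable.

Lemma measurable_time_strip (R : realType) (a b : R) :
  measurable [set p : R * R | a <= p.1 <= b].
Proof.
have -> : [set p : R * R | a <= p.1 <= b] = fst @^-1` `[a, b]%classic.
  by apply/seteqP; split => p /=; rewrite in_itv.
by rewrite -[X in measurable X]setTI; exact: measurable_fst.
Qed.

(** A functional of one path, so that it can be evaluated on shifted paths and on those produced by
    [F]. *)
Definition entrance_payoff (R : realType) (D : set (R * R)) (m : R)
    (g : R * R -> \bar R) (z : R -> R) : \bar R :=
  g (entrance_time D m z, z (entrance_time D m z)).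

Lemma measurable_entrance_payoff (R : realType) (d : measure_display)
    (T : measurableType d) (Z : R -> T -> R) (D : set (R * R)) (m : R)
    (g : R * R -> \bar R) :
  (forall w, {within `[0, +oo[, continuous (Z ^~ w)}) ->
  (forall q, 0 <= q -> measurable_fun setT (Z q)) -> closed D -> 0 <= m ->
  measurable_fun [set p | 0 <= p.1 <= m] g ->
  measurable_fun setT (fun w => entrance_payoff D m g (Z ^~ w)).
Proof.
move=> cZ mZ cD m0 mg.
have mE := measurable_entrance_time cZ cD m0 mZ.
have Eitv w := entrance_time_itv D (Z ^~ w) m0.
apply: (@measurable_comp _ _ _ _ _ _ [set p | 0 <= p.1 <= m] g setT
  (fun w => (entrance_time D m (Z ^~ w), Z (entrance_time D m (Z ^~ w)) w))) => //.
- exact: measurable_time_strip.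
- by move=> _ [w _ <-]; exact: Eitv.
- apply: measurable_fun_pair => //.
  by apply: measurable_fun_sample => // w; have /andP[] := Eitv w.
Qed.

Lemma eq_entrance_payoff (R : realType) (D : set (R * R)) (m : R)
    (g : R * R -> \bar R) (z z' : R -> R) : 0 <= m ->
  (forall t, 0 <= t -> z t = z' t) ->
  entrance_payoff D m g z = entrance_payoff D m g z'.
Proof.
move=> m0 zz'; rewrite /entrance_payoff.
have -> : entrance_time D m z = entrance_time D m z'.
  rewrite /entrance_time; congr (inf (_ `|` _)).
  by apply/seteqP; split=> q /= [/[dup] qm /andP[q0 _]]; rewrite zz'.
by rewrite zz'//; have /andP[] := entrance_time_itv D z' m0.
Qed.

(** * Markov property *)

Section Markov.
Context {R : realType} {d : measure_display} {Omega : measurableType d}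
  (P : probability Omega R) (Ft : R -> set (set Omega)) (B : R -> Omega -> R)
  (mu sigma : R -> R) (F : R -> (R -> R) -> R -> R).
Hypotheses (cF : complete_filtration P Ft) (bB : brownian_motion P Ft B)
  (cmu : continuous mu) (csigma : continuous sigma)
  (sF : strong_solution mu sigma F) (uF : pathwise_unique mu sigma).

Let random_cst (S : set (set Omega)) (y : R) :
  sigma_algebra setT S -> random_in S (fun=> y).
Proof.
move=> sS K mK; have [s0 sC _] := sS; rewrite preimage_cst.
by case: ifP => _ //; rewrite -(setD0 setT); exact: sC.
Qed.

Lemma strong_solution_flow (X : R -> Omega -> R) (x s : R) : 0 <= s ->
  sde_solution mu sigma P Ft B (fun=> x) X ->
  {ae P, forall w t, 0 <= t ->
    X (s + t) w = F (X s w) (fun r => B (s + r) w - B s w) t}.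
Proof.
move=> s0 hX; have [aX _ _ _] := hX.
have cF' := complete_filtration_shift cF s0.
have bB' := brownian_motion_shift cF s0 bB.
have rX : random_in (Ft (s + 0)) (X s) by rewrite addr0; exact: aX.
have sol := sde_solution_shift cF bB cmu csigma s0 hX.
exact: (uF cF' bB' rX sol (sF.2 _ _ _ _ _ _ cF' bB' rX)).
Qed.

Lemma strong_solution_start (Y : R -> Omega -> R) (y : R) :
  sde_solution mu sigma P Ft B (fun=> y) Y ->
  {ae P, forall w t, 0 <= t -> Y t w = F y (B ^~ w) t}.
Proof.
move=> hY; have [sFt _ _ _] := cF.
have ry : random_in (Ft 0) (fun=> y) by apply: random_cst; exact: sFt.
exact: (uF cF bB ry hY (sF.2 _ _ _ _ _ _ cF bB ry)).
Qed.

(** A freezing argument: [X x s] and [\1_A] belong to the past, the increments after [s] are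
    independent of it, and integrating these out with the position frozen at [y] gives [phi y].
    Nonnegativity of [g] spares any integrability condition. *)
Lemma markov_property (X : R -> R -> Omega -> R) (x s m : R) (A : set Omega)
    (D : set (R * R)) (g : R * R -> \bar R) :
  (forall y, sde_solution mu sigma P Ft B (fun=> y) (X y)) ->
  0 <= s -> Ft s A -> closed D -> 0 <= m ->
  measurable_fun [set p | 0 <= p.1 <= m] g -> (forall p, 0 <= g p)%E ->
  let phi y := (\int[P]_w entrance_payoff D m g (X y ^~ w))%E in
  measurable_fun setT phi /\
  (\int[P]_(w in A) entrance_payoff D m g (fun t => X x (s + t)%R w) =
   \int[P]_(w in A) phi (X x s w))%E.
Proof.
move=> hX s0 FA cD m0 mg g0 phi.
have [sFt Fm Fmono Fn] := cF.
have cF' := complete_filtration_shift cF s0.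
have bB' := brownian_motion_shift cF s0 bB.
have mA : measurable A by exact: (Fm s).
pose Bs r w := B (s + r) w - B s w.
pose good (om : R -> R) := forall y, {within `[0, +oo[, continuous (F y om)}.
have goodB w : good (B ^~ w).
  move=> y; have ry : random_in (Ft 0) (fun=> y) by apply: random_cst; exact: sFt.
  by have [_ + _ _] := sF.2 _ _ _ _ _ _ cF bB ry; apply.
have goodBs w : good (Bs ^~ w).
  move=> y; have ry : random_in (Ft (s + 0)) (fun=> y).
    by apply: random_cst; rewrite addr0; exact: sFt.
  by have [_ + _ _] := sF.2 _ _ _ _ _ _ cF' bB' ry; apply.
(* On the paths om for which every F y om is continuous, the entrance payoff of
   F y om is a measurable function of (y, om). *)
pose T0 : pointedType := HB.pack {om : R -> R | good om}
  (gen_eqMixin {om | good om}) (gen_choiceMixin {om | good om})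
  (isPointed.Build {om | good om} (exist _ _ (goodB point))).
pose v : T0 -> g_sigma_algebraType (@cylinders R) := fun om => sval om.
pose T2 := g_sigma_algebra_preimageType v.
have mv : @measurable_fun _ _ T2 (g_sigma_algebraType (@cylinders R)) setT v.
  by move=> _ K mK; rewrite setTI; exists K => //; rewrite setTI.
have toT2 (C : R -> Omega -> R) (gC : forall w, good (C ^~ w)) :
    (forall t, 0 <= t -> measurable_fun setT (C t)) ->
    @measurable_fun _ _ Omega T2 setT (fun w => exist good (C ^~ w) (gC w) : T0).
  move=> mC _ _ [K mK <-]; rewrite !setTI.
  by have := measurable_fun_path mC measurableT mK; rewrite setTI.
have mB : forall t, 0 <= t -> measurable_fun setT (B t) by have [] := bB.
have mBs : forall t, 0 <= t -> measurable_fun setT (Bs t) by have [] := bB'.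
pose W : Omega -> T2 := fun w => exist good (Bs ^~ w) (goodBs w) : T0.
have mW : measurable_fun setT W by exact: toT2.
pose W0 : Omega -> T2 := fun w => exist good (B ^~ w) (goodB w) : T0.
have mW0 : measurable_fun setT W0 by exact: toT2.
pose W0' : {mfun Omega >-> T2} := HB.pack W0 (isMeasurableFun.Build _ _ _ _ _ mW0).
pose Q : probability T2 R := distribution P W0'.
have aX : adapted Ft (X x) by have [] := hX x.
pose U w : R * R := (X x s w, \1_A w).
have mUs : @measurable_fun _ _ (g_sigma_algebraType (Ft s)) (R * R)%type setT U.
  apply: measurable_fun_pair.
    by apply/(sub_sigma_algebra_measurable_fun _ (sFt _ s0)); exact: aX.
  by apply: measurable_indic; exact/(sigma_algebra_measurableE _ (sFt _ s0)).
have FU K : measurable K -> Ft s (U @^-1` K).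
  by move: K; apply/(sub_sigma_algebra_measurable_fun _ (sFt _ s0)).
have mU : measurable_fun setT U.
  by move=> _ K mK; rewrite setTI; apply: (Fm s) => //; exact: FU.
have ind K1 K2 : measurable K1 -> measurable K2 ->
    P (U @^-1` K1 `&` W @^-1` K2) = (P (U @^-1` K1) * Q K2)%E.
  move=> mK1 [K mK <-]; rewrite setTI.
  have FU1 : Ft (s + 0) (U @^-1` K1) by rewrite addr0; exact: FU.
  exact: (brownian_law cF bB cF' bB' FU1 mK).
pose Z t (q : (R * R) * T2) : R := F q.1.1 (v q.2) t.
have cZ q : {within `[0, +oo[, continuous (Z ^~ q)} by exact: (svalP q.2).
have mZ t : 0 <= t -> measurable_fun setT (Z t).
  move=> t0; have mFt := sF.1 t t0.
  apply: (measurableT_comp (f := fun q : R * g_sigma_algebraType (@cylinders R) =>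
    F q.1 q.2 t) (g := fun q : (R * R) * T2 => (q.1.1, v q.2))) => //.
  apply: measurable_fun_pair; first by apply: measurableT_comp.
  exact: (measurableT_comp mv).
pose f (q : (R * R) * T2) := ((`|q.1.2|)%:E * entrance_payoff D m g (Z ^~ q))%E.
have mpay : measurable_fun setT (fun q => entrance_payoff D m g (Z ^~ q)).
  exact: measurable_entrance_payoff.
have mf : measurable_fun setT f.
  apply: emeasurable_funM => //; apply/measurable_EFinP.
  by apply: measurableT_comp => //; apply: measurableT_comp.
have f0 q : (0 <= f q)%E by apply: mule_ge0; [rewrite lee_fin|exact: g0].
(* [X y] is almost surely [F y] driven by [B], whose law is [Q]; the coordinate [i] is a placeholder
   for the indicator of [A]. *)
have phiE y i : phi y = (\int[Q]_om entrance_payoff D m g (Z ^~ ((y, i), om)))%E.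
  have mpay1 : measurable_fun setT (fun om : T2 => entrance_payoff D m g (Z ^~ ((y, i), om))).
    by apply: (measurableT_comp (g := fun om : T2 => ((y, i), om)) mpay);
      apply: measurable_fun_pair.
  have -> : (\int[Q]_om entrance_payoff D m g (Z ^~ ((y, i), om)) =
      \int[P]_w entrance_payoff D m g (Z ^~ ((y, i), W0 w)))%E.
    exact: (ge0_integral_distribution W0' mpay1 (fun=> g0 _)).
  have [aXy cXy _ _] := hX y.
  apply: ge0_ae_eq_integral => //.
  - apply: measurable_entrance_payoff => // q q0 _ K mK.
    by rewrite setTI; apply: (Fm q) => //; exact: aXy.
  - exact: (measurableT_comp mpay1 mW0).
  - by move=> w _; exact: g0.
  - by move=> w _; exact: g0.
  - apply: filterS (strong_solution_start (hX y)) => w h _.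
    exact: eq_entrance_payoff.
have mphi : measurable_fun setT phi.
  have h := measurable_fun_fubini_tonelli_F (m2 := Q)
    (fun q => entrance_payoff D m g (Z ^~ q)) mpay (fun=> g0 _).
  have -> : phi = (fun q => \int[Q]_om entrance_payoff D m g (Z ^~ (q, om)))%E \o
      (fun y : R => (y, 0 : R)) by apply/funext => y /=; exact: phiE.
  by apply: (measurableT_comp h); apply: measurable_fun_pair.
split => //.
have mkc (h : Omega -> \bar R) :
    (\int[P]_(w in A) h w = \int[P]_w ((\1_A w)%:E * h w))%E.
  rewrite integral_mkcond; apply: eq_integral => w _; rewrite patchE indicE.
  by case: (w \in A); rewrite ?mul1e ?mul0e.
have mpayW : measurable_fun setT (fun w => entrance_payoff D m g (Z ^~ (U w, W w))).
  by apply: (measurableT_comp (g := fun w => (U w, W w)) mpay); apply: measurable_fun_pair.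
have [_ cX _ _] := hX x.
have -> : (\int[P]_(w in A) entrance_payoff D m g (fun t => X x (s + t)%R w) =
    \int[P]_(w in A) entrance_payoff D m g (Z ^~ (U w, W w)))%E.
  apply: ge0_ae_eq_integral => //.
  - apply: measurable_funTS.
    apply: (measurable_entrance_payoff (Z := fun t => X x (s + t))) => //.
      exact: (continuous_paths_shift s0 cX).
    move=> q q0 _ K mK; have sq0 := addr_ge0 s0 q0.
    by rewrite setTI; apply: (Fm _ sq0); exact: aX.
  - exact: measurable_funTS.
  - by move=> w _; exact: g0.
  - by move=> w _; exact: g0.
  - apply: filterS (strong_solution_flow s0 (hX x)) => w h _.
    exact: eq_entrance_payoff.
rewrite !mkc.
have -> : (\int[P]_w ((\1_A w)%:E * entrance_payoff D m g (Z ^~ (U w, W w))) =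
    \int[P]_w f (U w, W w))%E.
  by apply: eq_integral => w _; rewrite /f/= ger0_norm.
rewrite (integral_independent mU mW ind mf f0).
apply: eq_integral => w _; rewrite (phiE _ (\1_A w)).
have mpay2 : measurable_fun setT (fun om : T2 => entrance_payoff D m g (Z ^~ (U w, om))).
  by apply: (measurableT_comp (g := fun om : T2 => (U w, om)) mpay);
    apply: measurable_fun_pair.
transitivity (\int[Q]_om ((\1_A w)%:E * entrance_payoff D m g (Z ^~ (U w, om))))%E.
  by apply: eq_integral => om _; rewrite /f/= ger0_norm.
by apply: ge0_integralZl => // om _; exact: g0.
Qed.

End Markov.

(** * Time zero *)

Lemma nondecreasing_measure_gt (R : realType) (d : measure_display)
    (T : measurableType d) (m : {measure set T -> \bar R}) (S : nat -> set T)
    (a : \bar R) :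
  (forall n, measurable (S n)) -> {homo S : i j / (i <= j)%N >-> i `<=` j} ->
  (a < m (\bigcup_n S n))%E ->
  exists n0, forall n, (n0 <= n)%N -> (a < m (S n))%E.
Proof.
move=> mS ndS aS.
have cvgS : m \o S @ \oo --> m (\bigcup_n S n).
  apply: nondecreasing_cvg_mu => //; first exact: bigcupT_measurable.
  by move=> i j ij; apply/subsetPset; exact: ndS.
have [n0 an0] : exists n0, (a < m (S n0))%E.
  apply: contrapT => /forallNP h; move: aS; apply/negP; rewrite -leNgt.
  rewrite -(cvg_lim _ cvgS)//; apply: lime_le.
    by apply/cvg_ex; exists (m (\bigcup_n S n)).
  by apply: nearW => n /=; rewrite leNgt; apply/negP; exact: h.
exists n0 => n n0n; apply: lt_le_trans an0 _.
by apply: le_measure; rewrite ?inE//; exact: ndS.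
Qed.

Lemma hits_mono (R : realType) (D : set (R * R)) (r r' : R) (z : R -> R) :
  r <= r' -> hits D r z -> hits D r' z.
Proof. by move=> rr' [q /andP[q0 qr] Dq]; exists q => //; rewrite q0 (le_trans qr). Qed.

(** * Switching between two stopping rules *)

Section Switching.
Context {R : realType} {d : measure_display} {Omega : measurableType d}
  (P : probability Omega R) (Ft : R -> set (set Omega)).
Hypothesis cF : complete_filtration P Ft.

Lemma admissible_measurable (m : R) (tau : Omega -> R) :
  admissible Ft m tau -> measurable_fun setT tau.
Proof.
have [_ Fm _ _] := cF; move=> [tau0 Ftau].
apply: (measurability _ (RGenOInfty.measurableE R)) => //.
move=> _ [_ [r ->] <-]; rewrite preimage_itvoy setTI.
have -> : [set w | r < tau w] = ~` [set w | tau w <= r].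
  by apply/seteqP; split => w /=; rewrite ltNge => /negP.
apply: measurableC; have [r0|r0] := leP 0 r; first by apply: (Fm r r0); exact: Ftau.
rewrite (_ : [set _ | _] = set0)//; apply/seteqP; split => // w /= h.
by have := le_lt_trans h r0; rewrite ltNge; case/andP: (tau0 w) => ->.
Qed.

Lemma filtration_hits (X : R -> Omega -> R) (D : set (R * R)) (s r : R) :
  adapted Ft X -> continuous_paths X -> closed D -> 0 <= s -> 0 <= r ->
  Ft (s + r) [set w | hits D r (fun t => X (s + t) w)].
Proof.
have [sF _ Fmono _] := cF; move=> aX cX cD s0 r0.
have sr0 := addr_ge0 s0 r0.
apply/(sigma_algebra_measurableE _ (sF _ sr0)).
apply: (@measurable_hits _ _ (g_sigma_algebraType (Ft (s + r))) (fun t => X (s + t))) => //.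
  exact: (continuous_paths_shift s0 cX).
move=> q /andP[q0 qr]; have sq0 := addr_ge0 s0 q0.
apply/(sub_sigma_algebra_measurable_fun _ (sF _ sr0)) => K mK.
by apply: (Fmono _ _ sq0); [rewrite lerD2l|exact: aX].
Qed.

Definition switch_time (X : R -> Omega -> R) (D1 D2 : set (R * R)) (s m : R)
    (E : set Omega) (w : Omega) : R :=
  if w \in E then s + entrance_time D2 m (fun t => X (s + t) w)
  else entrance_time D1 s (X ^~ w).

(** On [E] the set [D1] has not been hit by time [s]. Hence before [s] stopping means having hit
    [D1], with no reference to [E], which is known only at time [s]; from [s] on, [E] belongs to the
    past. *)
Lemma switch_time_admissible (X : R -> Omega -> R) (D1 D2 : set (R * R))
    (s m : R) (E : set Omega) :
  adapted Ft X -> continuous_paths X -> closed D1 -> closed D2 ->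
  0 <= s -> 0 <= m -> Ft s E -> (forall w, E w -> ~ hits D1 s (X ^~ w)) ->
  admissible Ft (s + m) (switch_time X D1 D2 s m E).
Proof.
have [sF _ Fmono _] := cF; move=> aX cX cD1 cD2 s0 m0 FE Eh.
have cXs := continuous_paths_shift s0 cX.
have i1 w := entrance_time_itv D1 (X ^~ w) s0.
have i2 w := entrance_time_itv D2 (fun t => X (s + t) w) m0.
split=> [w|r r0].
  rewrite /switch_time; case: ifP => _.
    by have := i2 w; move: s0; clear; lra.
  by have := i1 w; move: m0; clear; lra.
have Fr := sF _ r0.
have [rs|sr] := ltP r s.
  have -> : [set w | switch_time X D1 D2 s m E w <= r] =
      [set w | hits D1 r (fun t => X (0 + t) w)].
    have e0 w : (fun t => X (0 + t) w) = X ^~ w by apply/funext => t; rewrite add0r.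
    apply/seteqP; split=> w /=; rewrite e0 /switch_time.
      case: ifPn => [_|_]; last by move/(entrance_time_leP cD1 s0 (cX w) r0 rs).
      by have := i2 w; move: rs; clear; lra.
    move=> h; have /negP/negbTE -> : ~ (w \in E).
      by rewrite inE => /Eh; apply; exact: hits_mono (ltW rs) h.
    exact/(entrance_time_leP cD1 s0 (cX w) r0 rs).
  have := filtration_hits aX cX cD1 (lexx 0) r0; by rewrite add0r.
have rs0 : 0 <= r - s by rewrite subr_ge0.
pose H := [set w | entrance_time D2 m (fun t => X (s + t) w) <= r - s].
have -> : [set w | switch_time X D1 D2 s m E w <= r] = ~` E `|` (E `&` H).
  apply/seteqP; split=> w /=; rewrite /switch_time /H/=.
    have [wE|wE] := pselect (E w); last by left.
    by rewrite mem_set// -lerBrDl; right.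
  have [wE|wE] := pselect (E w).
    by rewrite mem_set// -lerBrDl; case=> // -[].
  by rewrite memNset// => _; apply: le_trans sr; case/andP: (i1 w).
have FEr : Ft r E by exact: (Fmono s).
have FH : Ft r H.
  rewrite /H; have [mr|rm] := leP m (r - s).
    rewrite (_ : [set _ | _] = setT).
      by apply/(sigma_algebra_measurableE _ Fr); exact: measurableT.
    by apply/seteqP; split => // w _ /=; apply: le_trans mr; case/andP: (i2 w).
  have := filtration_hits aX cX cD2 s0 rs0; rewrite addrC subrK.
  rewrite (_ : [set w | hits _ _ _] = [set w | entrance_time D2 m (fun t => X (s + t) w) <= r - s])//.
  apply/seteqP; split=> w /=;
    by rewrite (entrance_time_leP cD2 m0 (cXs w) rs0 rm).
move: FEr FH; rewrite !(sigma_algebra_measurableE _ Fr) => mE mH.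
by apply: measurableU; [exact: measurableC|exact: measurableI].
Qed.

End Switching.

(** A path strictly outside the ball at its exit time was already outside a little earlier, by
    continuity; the start [z 0 = x] ensures that there are earlier times. *)
Lemma entrance_time_ball (R : realType) (z : R -> R) (x eta s : R) :
  0 <= s -> 0 < eta -> {within `[0, +oo[, continuous z} -> z 0 = x ->
  let i := entrance_time [set q : R * R | eta <= `|q.2 - x|] s z in
  `|z i - x| <= eta.
Proof.
move=> s0 eta0 cz z0; set i := entrance_time _ _ _; cbv zeta.
have /andP[i0 is_] := entrance_time_itv [set q : R * R | eta <= `|q.2 - x|] z s0.
rewrite -/i in i0 is_; rewrite leNgt; apply/negP => zi.
have e0 : 0 < `|z i - x| - eta by rewrite subr_gt0.
have /continuous_halflineP/(_ i i0 _ e0)[del del0 hdel] := cz.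
have ip : 0 < i.
  rewrite lt_neqAle i0 andbT; apply/eqP => i0E.
  by move: zi; rewrite -i0E z0 subrr normr0 ltNge (ltW eta0).
pose u := Num.max 0 (i - del / 2).
have u0 : 0 <= u by rewrite /u le_max lexx.
have ui : u < i by rewrite /u gt_max ip; move: del0; clear; lra.
have udel : `|u - i| < del.
  have : i - del / 2 <= u by rewrite /u le_max lexx orbT.
  by rewrite ltr_norml; move: ui del0; clear; lra.
have := hdel u u0 udel => zu.
have uD : eta <= `|z u - x|.
  have := ler_distD (z u) (z i) x; rewrite (distrC (z i) (z u)).
  by move: zu; clear; lra.
suff : i <= u by rewrite leNgt ui.
apply: ge_inf; first by exists 0 => q [[/andP[q0 _] _]|->].
by left; split => //; rewrite u0/= (le_trans (ltW ui)).
Qed.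

Lemma closed_ball_complement (R : realType) (x eta : R) :
  closed [set q : R * R | eta <= `|q.2 - x|].
Proof.
apply: (@closed_comp _ _ (fun q : R * R => `|q.2 - x|) [set y | eta <= y]).
  move=> q _; apply: (@cvg_norm _ _ _ _ _ (fun q : R * R => q.2 - x)).
  by apply: cvgB; [exact: cvg_snd|exact: cvg_cst].
exact: closed_ge.
Qed.

(** On [E] only the integrals of the positive and negative parts are known, through [vP] and [vN];
    the bound [k] makes both finite, so that they can be subtracted. Off [E] the function stays
    within [b] of [g]. *)
Lemma integral_split_lower_bound (R : realType) (d : measure_display)
    (Omega : measurableType d) (P : probability Omega R) (E : set Omega)
    (f : Omega -> R) (vP vN : Omega -> \bar R) (k a g b : R) :
  measurable E -> measurable_fun setT f ->
  measurable_fun setT vP -> measurable_fun setT vN ->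
  (forall w, 0 <= vP w)%E -> (forall w, 0 <= vN w)%E ->
  (forall w, E w -> vP w + vN w <= k%:E)%E ->
  (\int[P]_(w in E) ((EFin \o f)^\+ w) = \int[P]_(w in E) vP w)%E ->
  (\int[P]_(w in E) ((EFin \o f)^\- w) = \int[P]_(w in E) vN w)%E ->
  (forall w, E w -> a%:E <= vP w - vN w)%E ->
  (forall w, ~ E w -> `|f w - g| <= b) ->
  ((a * fine (P E) + (g - b) * (1 - fine (P E)))%:E <= \int[P]_w (f w)%:E)%E.
Proof.
move=> mE mf mvP mvN vP0 vN0 vk fP fN av fb.
have PEfin : P E \is a fin_num by exact: fin_num_measure.
have intk : P.-integrable E (cst k%:E) by exact: finite_measure_integrable_cst.
have k0 w : E w -> (0 <= k%:E)%E.
  by move=> Ew; apply: le_trans (vk w Ew); exact: adde_ge0.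
have vPk w : E w -> (vP w <= k%:E)%E.
  by move=> Ew; apply: le_trans (vk w Ew); exact: leeDl.
have vNk w : E w -> (vN w <= k%:E)%E.
  by move=> Ew; apply: le_trans (vk w Ew); exact: leeDr.
have ivP : P.-integrable E vP.
  apply: le_integrable intk => //; first exact: measurable_funTS.
  by move=> w Ew; rewrite !gee0_abs ?vPk// (k0 w).
have ivN : P.-integrable E vN.
  apply: le_integrable intk => //; first exact: measurable_funTS.
  by move=> w Ew; rewrite !gee0_abs ?vNk// (k0 w).
have mEf D : measurable_fun D (EFin \o f) by apply: measurable_funTS; exact/measurable_EFinP.
have ifC : P.-integrable (~` E) (EFin \o f).
  have intc : P.-integrable (~` E) (cst (`|g| + b)%:E).
    by apply: finite_measure_integrable_cst; exact: measurableC.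
  apply: le_integrable intc => //; first exact: measurableC.
  move=> w nEw /=; rewrite lee_fin.
  have := fb w nEw => h.
  have b0 : 0 <= b by apply: le_trans h.
  rewrite (ger0_norm (addr_ge0 (normr_ge0 g) b0)).
  have := ler_distD g (f w) 0; rewrite !subr0; move: h; clear; lra.
have mC : measurable (~` E) by exact: measurableC.
have mfT : measurable_fun setT (EFin \o f) by exact: mEf.
have -> : (\int[P]_w (f w)%:E =
    \int[P]_(w in E) (f w)%:E + \int[P]_(w in ~` E) (f w)%:E)%E.
  by rewrite -integral_setU ?setUv//; apply/disj_set2P; rewrite setICr.
have hE : ((a * fine (P E))%:E <= \int[P]_(w in E) (f w)%:E)%E.
  rewrite integralE fP fN -integralB// EFinM fineK// -integral_cst//.
  apply: le_integral => //; [exact: finite_measure_integrable_cst|exact: integrableB|].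
  by move=> w; rewrite inE => Ew; exact: av.
have hC : (((g - b) * (1 - fine (P E)))%:E <= \int[P]_(w in ~` E) (f w)%:E)%E.
  rewrite EFinM.
  have -> : (1 - fine (P E))%:E = P (~` E) by rewrite probability_setC// EFinB fineK.
  rewrite -integral_cst//; apply: le_integral => //; first exact: finite_measure_integrable_cst.
  move=> w; rewrite inE => nEw; rewrite lee_fin.
  by have := fb w nEw; rewrite ler_norml; clear; lra.
by rewrite EFinD; exact: leeD.
Qed.

Section TimeZero.
Context {R : realType} {d : measure_display} {Omega : measurableType d}
  (P : probability Omega R) (B : R -> Omega -> R) (mu sigma : R -> R)
  (X : R -> R -> Omega -> R) (T : R) (G V : R * R -> R).
Local Notation Ft := (natural_filtration P B).
Hypotheses (hP : measure_is_complete P) (hB : brownian_motion P Ft B)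
  (hSDE : unique_strong_solution mu sigma)
  (hX : forall x, sde_solution mu sigma P Ft B (fun=> x) (X x))
  (cmu : continuous mu) (csigma : continuous sigma) (hT : 0 < T)
  (hG : usc_on (strip T) G)
  (hV : forall p, strip T p -> value P Ft X T G p = (V p)%:E)
  (htau : forall p, strip T p ->
     admissible Ft (T - p.1) (tau_star X T G V p) /\
     gain P X G p (tau_star X T G V p) = (V p)%:E)
  (hD : closed (stopping_set T G V)).

Let cF : complete_filtration P Ft.
Proof. by apply: natural_filtration_complete => //; have [] := hB. Qed.

Let shifted_stopping (s : R) : set (R * R) :=
  [set q | stopping_set T G V (s + q.1, q.2)].

Let closed_shifted_stopping s : closed (shifted_stopping s).
Proof.
apply: (@closed_comp _ _ (fun q : R * R => (s + q.1, q.2)) (stopping_set T G V)) => //.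
move=> q _.
have c1 : s + p.1 @[p --> q] --> s + q.1.
  by apply: cvgD; [exact: cvg_cst|exact: cvg_fst].
have c2 : p.2 @[p --> q] --> q.2 by exact: cvg_snd.
exact: (cvg_pair c1 c2).
Qed.

Let tau_starE (s y : R) (w : Omega) : 0 <= s ->
  tau_star X T G V (s, y) w =
  entrance_time (shifted_stopping s) (T - s) (X y ^~ w).
Proof.
move=> s0; rewrite /tau_star /entrance_time/=; congr (inf (_ `|` _)).
apply/seteqP; split=> q /= [/[dup] qT /andP[q0 qTs] h]; split => //.
  by split => //; rewrite /strip/= addr_ge0//=; move: qTs; lra.
by case: h.
Qed.

Let gs (s : R) : R * R -> \bar R := fun q => (G (s + q.1, q.2))%:E.

Let measurable_G : measurable_fun (strip T) G.
Proof. by apply: usc_on_measurable => //; exact: measurable_time_strip. Qed.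

Let measurable_gs s : 0 <= s -> measurable_fun [set p | 0 <= p.1 <= T - s] (gs s).
Proof.
move=> s0; apply/measurable_EFinP.
apply: (@measurable_comp _ _ _ _ _ _ (strip T) G _ (fun q : R * R => (s + q.1, q.2))) => //.
- exact: measurable_time_strip.
- move=> _ [q /= /andP[q0 qT] <-]; rewrite /strip/= addr_ge0//=.
  by move: qT; lra.
- apply: measurable_funTS; apply: measurable_fun_pair => //.
  by apply: measurable_funD => //.
Qed.

Let phi (s : R) (g : R * R -> \bar R) (y : R) : \bar R :=
  (\int[P]_w entrance_payoff (shifted_stopping s) (T - s) g (X y ^~ w))%E.

Let value_phi s y : 0 <= s <= T ->
  (V (s, y))%:E = (phi s (gs s)^\+ y - phi s (gs s)^\- y)%E.
Proof.
move=> /andP[s0 sT]; have sp : strip T (s, y) by rewrite /strip/= s0.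
have [_ <-] := htau sp; rewrite /gain integralE /phi /entrance_payoff.
congr (_ - _)%E; apply: eq_integral => w _.
  by rewrite !funeposE/= tau_starE.
by rewrite !funenegE/= tau_starE.
Qed.

(** The difference is the real number [V (s, y)], and with [+oo - +oo = -oo] this excludes infinite
    terms. *)
Let phi_fin s y : 0 <= s <= T ->
  phi s (gs s)^\+%E y \is a fin_num /\ phi s (gs s)^\-%E y \is a fin_num.
Proof.
move=> sT; have := value_phi y sT.
have : (0 <= phi s (gs s)^\+ y)%E by apply: integral_ge0 => w _; exact: funepos_ge0.
have : (0 <= phi s (gs s)^\- y)%E by apply: integral_ge0 => w _; exact: funeneg_ge0.
by case: (phi s (gs s)^\+%E y) => [a| |]; case: (phi s (gs s)^\-%E y) => [b| |].
Qed.

(** The rule earns at least [G (0, x) + 3 c / 4] on [E] (the gap [c] less an oscillation [c / 4] of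
    [G]) and [G (0, x) - c / 4] elsewhere. Since [P E > 1 / 2], the mean exceeds [G (0, x) + c / 4],
    against [V (0, x) = G (0, x)]. *)
Lemma time_zero_no_gap (x c eta : R) : 0 < c -> 0 < eta ->
  (forall s y, 0 < s < eta -> `|y - x| < eta -> c <= V (s, y) - G (s, y)) ->
  V (0, x) = G (0, x) ->
  (forall e, 0 < e -> exists2 del, 0 < del &
    forall s y, 0 <= s < del -> `|y - x| < del -> `|G (s, y) - G (0, x)| < e) ->
  False.
Proof.
move=> c0 eta0 gap V0 Gcont.
have [sF Fm Fmono Fn] := cF.
have [[F strF] uF] := hSDE.
have [aX cX X0 _] := hX x.
have c40 : 0 < c / 4 by move: c0; lra.
have [del del0 Gdel] := Gcont _ c40.
pose eta1 := Num.min (del / 2) (eta / 2).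
have [e10 e1del e1eta] : [/\ 0 < eta1, eta1 < del & eta1 < eta].
  have h1 : eta1 <= del / 2 by rewrite /eta1 ge_min lexx.
  have h2 : eta1 <= eta / 2 by rewrite /eta1 ge_min lexx orbT.
  split; first by rewrite /eta1 lt_min; apply/andP; split; move: del0 eta0; lra.
    by move: h1 del0; lra.
  by move: h2 eta0; lra.
pose D1 := [set q : R * R | eta1 <= `|q.2 - x|].
have cD1 : closed D1 by exact: closed_ball_complement.
pose N0 := [set w | X x 0 w <> x].
have nN0 : P.-negligible N0 by exact: X0.
have FN0 : Ft 0 N0 by exact: Fn.
have mN0 : measurable N0 by exact: (Fm 0).
have PN0 : P N0 = 0%E by exact: measure_negligible.
pose Sr r := [set w | ~ hits D1 r (X x ^~ w)].
have FSr r : 0 <= r -> Ft r (Sr r).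
  move=> r0; have := filtration_hits cF aX cX cD1 (lexx 0) r0; rewrite add0r.
  have -> : [set w | hits D1 r (fun t => X x (0 + t) w)] = [set w | hits D1 r (X x ^~ w)].
    have e0 w : (fun t => X x (0 + t) w) = X x ^~ w by apply/funext => t; rewrite add0r.
    by apply/seteqP; split=> w /=; rewrite e0.
  by rewrite !(sigma_algebra_measurableE _ (sF _ r0)) => /measurableC.
pose S n := Sr n.+1%:R^-1.
have n0 (n : nat) : 0 <= n.+1%:R^-1 :> R by rewrite invr_ge0.
have mS n : measurable (S n) by apply: (Fm _ (n0 n)); exact: FSr.
have ndS : {homo S : i j / (i <= j)%N >-> i `<=` j}.
  move=> i j ij w h1 h2; apply: h1; apply: hits_mono h2.
  by rewrite lef_pV2 ?posrE// ler_nat.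
(* Almost every path starts at [x] and, being continuous, stays within [eta1] of it for a short
   time. *)
have PS : ((1 / 2)%:E < P (\bigcup_n S n))%E.
  apply: (@lt_le_trans _ _ (P (~` N0))).
    by rewrite probability_setC// PN0 sube0 lte_fin; lra.
  apply: le_measure; rewrite ?inE//; [exact: measurableC|exact: bigcupT_measurable|].
  move=> w /= /contrapT w0.
  have /continuous_halflineP/(_ 0 (lexx 0) _ e10)[dl dl0 hdl] := cX w.
  have [n _ hn] := near_infty_natSinv_lt (PosNum dl0).
  exists n => // -[q /andP[q0 qn] /= Dq].
  have {}Dq : eta1 <= `|X x q w - x| := Dq.
  have qdl : `|q - 0| < dl.
    by rewrite subr0 ger0_norm//; exact: le_lt_trans qn (hn n (leqnn n)).
  by have := hdl q q0 qdl; rewrite w0 ltNge Dq.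
have [m1 hm1] := nondecreasing_measure_gt mS ndS PS.
have mn0 : 0 < Num.min eta1 T by rewrite lt_min e10.
have [m2 _ hm2] := near_infty_natSinv_lt (PosNum mn0).
pose n := maxn m1 m2.
have PSn : ((1 / 2)%:E < P (S n))%E by apply: hm1; exact: leq_maxl.
pose s : R := n.+1%:R^-1.
have s0 : 0 < s by rewrite invr_gt0.
have /andP[se1 sT] : (s < eta1) && (s < T).
  by rewrite -lt_min; apply: (hm2 n) => /=; exact: leq_maxr.
have sT' : 0 <= s <= T by rewrite !ltW.
have m0 : 0 <= T - s by rewrite subr_ge0 ltW.
pose D2 := shifted_stopping s.
have cD2 : closed D2 by exact: closed_shifted_stopping.
pose gp := (gs s)^\+%E; pose gn := (gs s)^\-%E.
have mgp : measurable_fun [set p | 0 <= p.1 <= T - s] gp.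
  by apply: measurable_funepos; apply: measurable_gs; exact: ltW.
have mgn : measurable_fun [set p | 0 <= p.1 <= T - s] gn.
  by apply: measurable_funeneg; apply: measurable_gs; exact: ltW.
have gp0 p : (0 <= gp p)%E by exact: funepos_ge0.
have gn0 p : (0 <= gn p)%E by exact: funeneg_ge0.
have MP A (FA : Ft s A) := markov_property cF hB cmu csigma strF uF x hX (ltW s0) FA
  cD2 m0 mgp gp0.
have MN A (FA : Ft s A) := markov_property cF hB cmu csigma strF uF x hX (ltW s0) FA
  cD2 m0 mgn gn0.
have Fss := sF _ (ltW s0).
have FT : Ft s setT by apply/(sigma_algebra_measurableE _ Fss); exact: measurableT.
have mphiP : measurable_fun setT (phi s gp) by have [] := MP _ FT.
have mphiN : measurable_fun setT (phi s gn) by have [] := MN _ FT.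
(* The conditional expectations are finite at each position but not known to be bounded; these
   levels exhaust the line, so a large [k] costs little probability. *)
pose J (k : nat) := [set y | (phi s gp y + phi s gn y <= k%:R%:E)%E].
have mJ k : measurable (J k).
  have := emeasurable_fun_infty_c measurableT (emeasurable_funD mphiP mphiN) k%:R%:E.
  by rewrite setTI.
pose Ek k := S n `&` ~` N0 `&` X x s @^-1` J k.
have FE k : Ft s (Ek k).
  have h1 : Ft s (S n) by apply: FSr; exact: ltW.
  have h2 : Ft s N0 by exact: (Fmono 0 s (lexx _) (ltW s0)).
  have h3 : Ft s (X x s @^-1` J k) by apply: aX => //; exact: ltW.
  move: h1 h2 h3; rewrite !(sigma_algebra_measurableE _ Fss) => h1 h2 h3.
  by apply: measurableI => //; apply: measurableI => //; exact: measurableC.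
have mEk k : measurable (Ek k) by exact: (Fm s (ltW s0) _ (FE k)).
have ndE : {homo Ek : i j / (i <= j)%N >-> i `<=` j}.
  move=> i j ij w [h1 h2]; split => //; apply: le_trans h2 _.
  by rewrite lee_fin ler_nat.
have PE : ((1 / 2)%:E < P (\bigcup_k Ek k))%E.
  rewrite (@measure_eq_off_null _ _ _ P N0 _ (S n))//; first exact: bigcupT_measurable.
  apply/seteqP; split=> w /=; first by move=> [[k _ [[? ?] _]] ?].
  move=> [Sw nNw]; split => //.
  have [f1 f2] := phi_fin (X x s w) sT'.
  pose r := fine (phi s gp (X x s w)) + fine (phi s gn (X x s w)).
  exists (Num.truncn r).+1 => //; split => //=.
  rewrite /J/= -(fineK f1) -(fineK f2) -EFinD lee_fin -/r.
  have r0 : 0 <= r.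
    by apply: addr_ge0; apply: fine_ge0; apply: integral_ge0 => ? _; [exact: gp0|exact: gn0].
  by have /andP[_ /ltW] := truncn_itv r0.
have [k hk] := nondecreasing_measure_gt mEk ndE PE.
have {hk}PEk := hk k (leqnn k).
set E := Ek k in PEk.
have mE : measurable E := mEk k.
pose tau := switch_time (X x) D1 D2 s (T - s) E.
have atau : admissible Ft T tau.
  have {1}-> : T = s + (T - s) by rewrite addrC subrK.
  by apply: (switch_time_admissible cF aX cX cD1 cD2 (ltW s0) m0 (FE k)) => w [[]].
have [tau0 _] := atau.
have mtau := admissible_measurable cF atau.
have mX t : 0 <= t -> measurable_fun setT (X x t).
  by move=> t0 _ K mK; rewrite setTI; apply: (Fm t t0); exact: aX.
pose f w := G (tau w, X x (tau w) w).
have mf : measurable_fun setT f.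
  apply: (@measurable_comp _ _ _ _ _ _ (strip T) G _ (fun w => (tau w, X x (tau w) w))) => //.
  - exact: measurable_time_strip.
  - by move=> _ [w _ <-]; exact: tau0.
  - apply: measurable_fun_pair => //.
    by apply: measurable_fun_sample => // w; case/andP: (tau0 w).
(* On the null set [N0] the path does not start at [x] and may be far from it; the modification lets
   the bound off [E] hold at every point. *)
pose ft w := if w \in N0 then G (0, x) else f w.
have mft : measurable_fun setT ft.
  apply: measurable_fun_ifT => //.
  apply: (measurable_fun_bool true); rewrite setTI.
  rewrite [X in measurable X](_ : _ = N0)//.
  by apply/seteqP; split => w /=; [move/set_mem|move/mem_set].
have gle : (\int[P]_w (ft w)%:E <= (G (0, x))%:E)%E.
  have -> : (\int[P]_w (ft w)%:E = \int[P]_w (f w)%:E)%E.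
    apply: ae_eq_integral => //; [exact/measurable_EFinP|exact/measurable_EFinP|].
    exists N0; split => // w /= h; apply: contrapT => nN; apply: h => _.
    by rewrite /ft memNset.
  have st0 : strip T (0, x) by rewrite /strip/= lexx ltW.
  rewrite -V0 -(hV st0); apply: ereal_sup_ubound.
  exists tau; first by rewrite /= subr0.
  by rewrite /gain; apply: eq_integral => w _; rewrite /= add0r.
have onE w : E w -> [/\ ft w = G (s + entrance_time D2 (T - s) (fun t => X x (s + t) w),
      X x (s + entrance_time D2 (T - s) (fun t => X x (s + t) w)) w)
    & `|X x s w - x| < eta1].
  move=> Ew; have [[nh nN] _] := Ew; split.
    by rewrite /ft memNset// /f /tau /switch_time mem_set.
  rewrite ltNge; apply/negP => h; apply: nh; exists s => //.
  by rewrite lexx ltW.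
have Gnear t y : 0 <= t <= s -> `|y - x| <= eta1 -> `|G (t, y) - G (0, x)| < c / 4.
  move=> /andP[t0 ts] yx; apply: Gdel; last exact: le_lt_trans e1del.
  by rewrite t0 (le_lt_trans ts)// (lt_trans se1).
have := @integral_split_lower_bound _ _ _ P E ft (fun w => phi s gp (X x s w))
  (fun w => phi s gn (X x s w)) k%:R (G (0, x) + 3 * c / 4) (G (0, x)) (c / 4) mE mft.
have PEfin : P E \is a fin_num by exact: fin_num_measure.
have pE : 1 / 2 < fine (P E) by rewrite -lte_fin fineK.
have pE1 : c * (1 / 2) < c * fine (P E) by rewrite ltr_pM2l.
have mXs : measurable_fun setT (X x s) by apply: mX; exact: ltW.
have h1 : measurable_fun setT (fun w => phi s gp (X x s w)).
  exact: (measurableT_comp mphiP mXs).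
have h2 : measurable_fun setT (fun w => phi s gn (X x s w)).
  exact: (measurableT_comp mphiN mXs).
move=> /(_ h1 h2).
have h3 w : (0 <= phi s gp (X x s w))%E by apply: integral_ge0 => ? _; exact: gp0.
have h4 w : (0 <= phi s gn (X x s w))%E by apply: integral_ge0 => ? _; exact: gn0.
move=> /(_ h3 h4).
have h5 w : E w -> (phi s gp (X x s w) + phi s gn (X x s w) <= k%:R%:E)%E by case.
move=> /(_ h5).
have h6 : (\int[P]_(w in E) ((EFin \o ft)^\+ w) =
    \int[P]_(w in E) phi s gp (X x s w))%E.
  have [_ <-] := MP _ (FE k); apply: eq_integral => w; rewrite inE => Ew.
  by rewrite /entrance_payoff /gp !funeposE /= /gs/=; have [-> _] := onE w Ew.
have h7 : (\int[P]_(w in E) ((EFin \o ft)^\- w) =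
    \int[P]_(w in E) phi s gn (X x s w))%E.
  have [_ <-] := MN _ (FE k); apply: eq_integral => w; rewrite inE => Ew.
  by rewrite /entrance_payoff /gn !funenegE /= /gs/=; have [-> _] := onE w Ew.
move=> /(_ h6 h7).
have h8 w : E w -> ((G (0, x) + 3 * c / 4)%:E <= phi s gp (X x s w) - phi s gn (X x s w))%E.
  move=> Ew; rewrite -value_phi// lee_fin.
  have [_ near] := onE w Ew.
  have g1 : c <= V (s, X x s w) - G (s, X x s w).
    by apply: gap; [rewrite s0 (lt_trans se1)|exact: lt_trans e1eta].
  have : `|G (s, X x s w) - G (0, x)| < c / 4.
    by apply: Gnear; [rewrite lexx ltW|exact: ltW].
  by rewrite ltr_norml; move: g1; lra.
move=> /(_ h8).
have h9 w : ~ E w -> `|ft w - G (0, x)| <= c / 4.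
  move=> nEw; rewrite /ft; case: ifPn => [_|]; first by rewrite subrr normr0 ltW.
  move=> /negP; rewrite inE => nN; have {nN}X0w : X x 0 w = x by exact: contrapT.
  rewrite /f /tau /switch_time memNset//; apply: ltW; apply: Gnear.
    exact: (entrance_time_itv D1 (X x ^~ w) (ltW s0)).
  exact: (entrance_time_ball (ltW s0) e10 (cX w) X0w).
move=> /(_ h9)/le_trans/(_ gle); rewrite lee_fin; apply/negP; rewrite -ltNge.
by move: pE1 c0; lra.
Qed.

End TimeZero.

(** * Jumps of the boundary *)

Lemma subinterval_avoiding (R : realFieldType) (S : seq R) (a b : R) : a < b ->
  exists a' b', [/\ a <= a', a' < b', b' <= b & forall x, a' < x < b' -> x \notin S].
Proof.
move=> ab; elim: S => [|y S [a' [b' [aa' a'b' b'b hS]]]]; first by exists a, b.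
have [/andP[ay yb]|nyab] := boolP (a' < y < b').
  exists y, b'; split => //; first by rewrite (le_trans aa')// ltW.
  move=> x /andP[yx xb]; rewrite inE negb_or gt_eqF//= hS//.
  by rewrite (lt_trans ay).
exists a', b'; split => // x xab; rewrite inE negb_or hS// andbT.
by apply: contraNneq nyab => <-.
Qed.

Section PlaneDerivatives.
Context {R : realType}.
Implicit Types (u v : R * R -> R) (p : R * R).

Lemma dtB u v p : derivable_t u p -> derivable_t v p ->
  derivable_t (fun q => u q - v q) p /\
  dt (fun q => u q - v q) p = dt u p - dt v p.
Proof.
move=> hu hv; split; first exact: (derivableB hu hv).
rewrite /dt !derive1E; exact: (deriveB hu hv).
Qed.

Lemma dxB u v p : derivable_x u p -> derivable_x v p ->
  derivable_x (fun q => u q - v q) p /\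
  dx (fun q => u q - v q) p = dx u p - dx v p.
Proof.
move=> hu hv; split; first exact: (derivableB hu hv).
rewrite /dx !derive1E; exact: (deriveB hu hv).
Qed.

(** First derivatives are required on a whole interval: [dx] of a difference splits only where both
    derivatives exist, and the outer [dx] looks at all nearby points. *)
Lemma dxxB u v (s x xl xr : R) : xl < x < xr ->
  (forall y, xl < y < xr -> derivable_x u (s, y) /\ derivable_x v (s, y)) ->
  derivable_x (dx u) (s, x) -> derivable_x (dx v) (s, x) ->
  derivable_x (dx (fun q => u q - v q)) (s, x) /\
  dx (dx (fun q => u q - v q)) (s, x) = dx (dx u) (s, x) - dx (dx v) (s, x).
Proof.
move=> /andP[lx xr_] huv hu hv.
have [h1 h2] := dxB hu hv.
have nearE : {near x, (fun y => dx u (s, y) - dx v (s, y)) =1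
    (fun y => dx (fun q => u q - v q) (s, y))}.
  near=> y; have [hy1 hy2] : derivable_x u (s, y) /\ derivable_x v (s, y).
    apply: huv; apply/andP; split; near: y;
      [exact: lt_nbhsr|exact: lt_nbhsl].
  by have [_ ->] := dxB hy1 hy2.
split; first exact: (near_eq_derivable nearE h1).
rewrite -h2 /dx !derive1E; apply/esym.
exact: (near_eq_derive (1 : R^o) nearE).
Unshelve. all: by end_near. Qed.

End PlaneDerivatives.

Lemma derive1_ge_increment (R : realType) (h : R -> R) (l a b : R) : a <= b ->
  (forall z, a <= z <= b -> derivable h z 1 /\ l <= derive1 h z) ->
  l * (b - a) <= h b - h a.
Proof.
rewrite le_eqVlt => /predU1P[<-|ab] hh; first by rewrite !subrr mulr0.
have [z||z] := @MVT _ h (derive1 h) a b ab.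
- rewrite in_itv/= => /andP[az zb].
  have [dh _] : derivable h z 1 /\ l <= derive1 h z by apply: hh; rewrite !ltW.
  exact: derivable_is_derive1.
- apply: derivable_within_continuous => z; rewrite in_itv/= => zab.
  by have [] := hh z zab.
- rewrite in_itv/= => /andP[az zb] ->.
  by rewrite ler_pM2r ?subr_gt0//; have [] : derivable h z 1 /\ l <= derive1 h z
    by apply: hh; rewrite !ltW.
Qed.

Lemma continuous_bounded_itv (R : realType) (f : R -> R) (a b : R) :
  continuous f -> exists2 K, 0 <= K & forall x, a <= x <= b -> `|f x| <= K.
Proof.
move=> cf; have [ab|ba] := leP a b; last first.
  by exists 0 => // x /andP[ax xb]; have := le_trans ax xb; rewrite leNgt ba.
have cn : {within `[a, b], continuous (fun x => `|f x|)}.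
  apply: continuous_subspaceT => x.
  by apply: (@cvg_norm _ _ _ _ _ f); exact: cf.
have [z _ hz] := EVT_max ab cn.
by exists `|f z| => // x xab; apply: hz; rewrite in_itv.
Qed.

Lemma pde_difference (R : comRingType) (vt vx vxx a m gt gx gxx : R) :
  vt + (a * vxx + m * vx) = 0 ->
  vt - gt + (a * (vxx - gxx) + m * (vx - gx)) = - (gt + (a * gxx + m * gx)).
Proof. by move=> h; rewrite -[LHS]subr0 -[X in _ - X]h; ring. Qed.

Lemma within_planeP (R : realType) (A : set (R * R)) (f : R * R -> R)
    (p : R * R) (e : R) : {within A, continuous f} -> A p -> 0 < e ->
  exists2 del, 0 < del & forall q, A q -> `|q.1 - p.1| < del ->
    `|q.2 - p.2| < del -> `|f q - f p| < e.
Proof.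
move=> /subspace_continuousP cf Ap e0.
have /cvgrPdist_lt/(_ e e0)/nbhs_planeP[del del0 h] := cf p Ap.
by exists del => // q Aq q1 q2; rewrite distrC; exact: h.
Qed.

Section RightJump.
Context {R : realType} (mu sigma : R -> R) (T : R) (G V : R * R -> R) (b : R -> R).
Local Notation C := (continuation_set T G V).
Hypotheses (hVC12 : C12 C V)
  (hVpde : forall p, C° p -> dt V p + generator mu sigma V p = 0)
  (cmu : continuous mu) (csigma : continuous sigma)
  (hmu : piecewise_C 2 mu) (hsigma : piecewise_C 3 sigma)
  (hC : C = [set p : R * R | 0 <= p.1 < T /\ b p.1 < p.2]).

(** The conclusion records what the contradiction needs: [xr <= b t], so that the same segment is in
    the stopping set at time [t], and membership in [A], so that continuity of [G] on [closure A]
    reaches time [t]. *)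
Lemma right_jump_gap (t e eps d0 : R) : 0 <= t -> 0 < e -> 0 < eps -> 0 < d0 ->
  (forall s, t < s < t + d0 -> s < T /\ b s <= b t - eps) ->
  let A := disc (t, b t) e `&` C in
  let H := fun p => dt G p + generator mu sigma G p in
  C12_closure A G ->
  (forall p, A° p ->
    [/\ derivable_x (dt G) p, {for p, continuous (dx (dt G))},
        derivable_x (dx (dx G)) p & {for p, continuous (dx (dx (dx G)))}]) ->
  (exists2 ell, 0 < ell & forall p, A° p -> derivable_x H p -> ell <= dx H p) ->
  (forall p, A° p -> dx G p <= dx V p) ->
  exists yb xr c d', [/\ 0 < c, 0 < d', yb < xr, xr <= b t &
    (forall s y, t < s < t + d' -> yb <= y < xr ->
       A (s, y) /\ c <= V (s, y) - G (s, y))].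
Proof.
move=> t0 e0 eps0 d00 bjump A H [GC12 _ _] G3 [ell ell0 Hell] uxge.
have [Smu [Smu1 _]] := hmu.
have [Ssi [Ssi1 _]] := hsigma.
(* [eps] keeps the rectangle above the boundary after the jump; the bounds [e / 2] on [kap] and on
   [d] keep it in the disc, since [2 (e / 2)^2 < e^2]. *)
pose kap := Num.min eps (e / 2).
have [k0 keps ke] : [/\ 0 < kap, kap <= eps & kap <= e / 2].
  by rewrite /kap lt_min !ge_min !lexx eps0 orbT/=; split => //; lra.
have [xl [xr [lxl lr rxr hS]]] := @subinterval_avoiding R (Smu ++ Ssi) (b t - kap) (b t) (ltac:(lra)).
pose d := Num.min d0 (e / 2).
have [d1 dd0 de] : [/\ 0 < d, d <= d0 & d <= e / 2].
  by rewrite /d lt_min !ge_min !lexx d00 orbT/=; split => //; lra.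
pose Q := [set p : R * R | t < p.1 < t + d /\ xl < p.2 < xr].
have QC p : Q p -> C p.
  move=> [/= p1 p2]; rewrite hC /=.
  have [sT bs] : p.1 < T /\ b p.1 <= b t - eps by apply: bjump; lra.
  by split; [apply/andP; split; lra|lra].
have QA p : Q p -> A p.
  move=> Qp; split; last exact: QC.
  case: Qp => /= p1 p2; rewrite /disc/=.
  have s1 : (p.1 - t) ^+ 2 <= (e / 2) ^+ 2.
    by rewrite -[leLHS]real_normK ?num_real// lerXn2r ?nnegrE//; [lra|rewrite ler_norml; lra].
  have s2 : (p.2 - b t) ^+ 2 <= (e / 2) ^+ 2.
    by rewrite -[leLHS]real_normK ?num_real// lerXn2r ?nnegrE//; [lra|rewrite ler_norml; lra].
  apply: (le_lt_trans (lerD s1 s2)).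
  have -> : (e / 2) ^+ 2 + (e / 2) ^+ 2 = e ^+ 2 / 2 by field.
  by have := exprn_gt0 2 e0; lra.
have oQ p : Q p -> nbhs p Q.
  move=> [/andP[p1 p2] /andP[p3 p4]]; apply/nbhs_planeP.
  pose r := Num.min (Num.min (p.1 - t) (t + d - p.1)) (Num.min (p.2 - xl) (xr - p.2)).
  have r0 : 0 < r by rewrite /r !lt_min; apply/andP; split; apply/andP; split; lra.
  have r1 : r <= p.1 - t by rewrite /r !ge_min lexx.
  have r2 : r <= t + d - p.1 by rewrite /r !ge_min lexx !orbT.
  have r3 : r <= p.2 - xl by rewrite /r !ge_min lexx !orbT.
  have r4 : r <= xr - p.2 by rewrite /r !ge_min lexx !orbT.
  exists r => // q; rewrite !ltr_norml => /andP[q1 q2] /andP[q3 q4].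
  by split; apply/andP; split; lra.
have QAi p : Q p -> A° p by move=> /oQ; apply: filterS; exact: QA.
have QCi p : Q p -> C° p by move=> /oQ; apply: filterS; exact: QC.
pose u p := V p - G p.
have GP p : Q p -> [/\ derivable_t G p, derivable_x G p & derivable_x (dx G) p] /\
    [/\ {for p, continuous G}, {for p, continuous (dt G)},
        {for p, continuous (dx G)} & {for p, continuous (dx (dx G))}].
  by move=> /QAi; exact: GC12.
have VP p : Q p -> [/\ derivable_t V p, derivable_x V p & derivable_x (dx V) p] /\
    [/\ {for p, continuous V}, {for p, continuous (dt V)},
        {for p, continuous (dx V)} & {for p, continuous (dx (dx V))}].
  by move=> /QCi; exact: hVC12.
have cs2 : continuous (fun x => sigma x ^+ 2 / 2).
  by move=> x; apply: cvgM; [apply: cvgM; exact: csigma|exact: cvg_cst].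
have [Ks Ks0 hKs] := @continuous_bounded_itv R (fun x => sigma x ^+ 2 / 2) xl xr cs2.
have [Km Km0 hKm] := @continuous_bounded_itv R mu xl xr cmu.
pose K := Num.max Ks Km.
have K0 : 0 <= K by rewrite /K le_max Ks0.
have coef x : xl < x < xr ->
    [/\ 0 <= sigma x ^+ 2 / 2, sigma x ^+ 2 / 2 <= K & `|mu x| <= K].
  move=> /andP[x1 x2]; have xI : xl <= x <= xr by rewrite !ltW.
  split.
  - by apply: divr_ge0 => //; exact: sqr_ge0.
  - by apply: (le_trans (ler_norm _)); rewrite /K le_max hKs.
  - by rewrite /K le_max hKm// orbT.
have hux s x : t < s < t + d -> xl < x < xr ->
    dt u (s, x) = dt V (s, x) - dt G (s, x) /\
    dx u (s, x) = dx V (s, x) - dx G (s, x) /\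
    dx (dx u) (s, x) = dx (dx V) (s, x) - dx (dx G) (s, x) /\
    [/\ derivable_t u (s, x), derivable_x u (s, x), derivable_x (dx u) (s, x),
        {for (s, x), continuous u} & 0 <= dx u (s, x)].
  move=> sI xI; have Qp : Q (s, x) by split.
  have [[Gt Gx Gxx] [Gc _ _ _]] := GP _ Qp.
  have [[Vt Vx Vxx] [Vc _ _ _]] := VP _ Qp.
  have [ut utE] := dtB Vt Gt.
  have [ux uxE] := dxB Vx Gx.
  have [|uxx uxxE] := @dxxB _ V G s x xl xr xI _ Vxx Gxx.
    move=> y yI; have Qy : Q (s, y) by split.
    by have [[_ ? _] _] := GP _ Qy; have [[_ ? _] _] := VP _ Qy.
  split; [exact: utE|split; [exact: uxE|split; [exact: uxxE|split]]].
  - exact: ut.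
  - exact: ux.
  - exact: uxx.
  - exact: (cvgB Vc Gc).
  - by rewrite uxE subr_ge0; apply: uxge; exact: QAi.
have hu s x : t < s < t + d -> xl < x < xr ->
    [/\ derivable_t u (s, x), derivable_x u (s, x), derivable_x (dx u) (s, x),
        {for (s, x), continuous u} & 0 <= dx u (s, x)].
  by move=> sI xI; have [_ [_ [_ h]]] := hux s x sI xI.
have hpde s x : t < s < t + d -> xl < x < xr ->
    dt u (s, x) + (sigma x ^+ 2 / 2 * dx (dx u) (s, x) + mu x * dx u (s, x)) = - H (s, x).
  move=> sI xI; have [-> [-> [-> _]]] := hux s x sI xI.
  have Qp : Q (s, x) by split.
  exact: (pde_difference _ _ _ (hVpde (QCi _ Qp))).
(* Away from the break points [mu] and [sigma] are derivable, and [G_tx], [G_xxx] exist, so [H] is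
   derivable in space and the mean value theorem integrates the bound [ell]. *)
have hH s x y : t < s < t + d -> xl < x -> x <= y -> y < xr ->
    ell * (y - x) <= H (s, y) - H (s, x).
  move=> sI xlx xy yr.
  apply: (@derive1_ge_increment _ (fun z => H (s, z))) => // z /andP[xz zy].
  have zI : xl < z < xr by rewrite (lt_le_trans xlx)//= (le_lt_trans zy).
  have Qz : Q (s, z) by split.
  have := hS z zI; rewrite mem_cat negb_or => /andP[zmu zsi].
  have [hm _] := Smu1 z zmu; have dmu : derivable mu z 1 := hm 0%N isT.
  have [hs _] := Ssi1 z zsi; have dsi : derivable sigma z 1 := hs 0%N isT.
  have [[Gt Gx Gxx] _] := GP _ Qz.
  have [Gtx _ Gxxx _] := G3 _ (QAi _ Qz).
  have dH : derivable_x H (s, z).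
    have ds2 := derivableM (derivableM dsi dsi) (derivable_cst (2^-1 : R) z 1).
    exact: (derivableD Gtx (derivableD (derivableM ds2 Gxxx) (derivableM dmu Gxx))).
  by split; [exact: dH|exact: (Hell _ (QAi _ Qz) dH)].
pose xb := (2 * xl + xr) / 3; pose yb := (xl + 2 * xr) / 3.
have [xb1 xyb yb1] : [/\ xl < xb, xb < yb & yb < xr].
  by rewrite /xb /yb; split; lra.
have [c c0 [d' /andP[d'0 d'd] hc]] := parabolic_spread_lower_bound d1 ell0 K0
  coef hu hpde hH xb1 xyb yb1.
exists yb, xr, c, d'; split => // s y /andP[ts sd] /andP[yy yr].
have sI : t < s < t + d by rewrite ts (lt_le_trans sd)// lerD2l.
have Qsy : Q (s, y) by split => //=; rewrite yr (lt_le_trans _ yy)//; exact: lt_trans xb1 xyb.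
split; first exact: QA.
(* Positivity at [xb], a point of the continuation set, turns the bound on the increment into one on
   [u (s, yb)]; monotonicity carries it to all larger [y]. *)
have uxb : 0 < u (s, xb).
  have /QC : Q (s, xb) by split => //=; rewrite xb1 (lt_trans xyb).
  by move=> [_]; rewrite subr_gt0.
have uyb := hc s (ltac:(by rewrite ts)).
have : u (s, yb) <= u (s, y).
  have := @derive1_ge_increment _ (fun z => u (s, z)) 0 yb y yy; rewrite mul0r subr_ge0; apply.
  move=> z /andP[yz zy].
  have zI : xl < z < xr.
    by rewrite (le_lt_trans zy)// andbT (lt_le_trans _ yz)//; exact: lt_trans xb1 xyb.
  by have [_ ? _ _ ?] := hu s z sI zI.
apply: le_trans; apply: (le_trans uyb).
by rewrite gerBl ltW.
Qed.

End RightJump.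

(** * Continuity of the boundary *)

Unset Implicit Arguments.

Theorem theorem3p3 (R : realType) (d : measure_display)
  (Omega : measurableType d) (P : probability Omega R)
  (B : R -> Omega -> R) (mu sigma : R -> R) (X : R -> R -> Omega -> R)
  (T : R) (G V : R * R -> R) (b : R -> R)
  (hP : measure_is_complete P)
  (hB : brownian_motion P (natural_filtration P B) B)
  (hSDE : unique_strong_solution mu sigma)
  (hX : forall x, sde_solution mu sigma P (natural_filtration P B) B
                    (fun=> x) (X x))
  (hT : 0 < T)
  (hV : forall p, strip T p ->
          value P (natural_filtration P B) X T G p = (V p)%:E)
  (htau : forall p, strip T p ->
          admissible (natural_filtration P B) (T - p.1)
            (tau_star X T G V p) /\
          gain P X G p (tau_star X T G V p) = (V p)%:E)
  (hCopen : exists2 U, open U &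
              continuation_set T G V = U `&` strip T)
  (hDclosed : closed (stopping_set T G V))
  (hVC12 : C12 (continuation_set T G V) V)
  (hVpde : forall p, (continuation_set T G V)° p ->
             dt V p + generator mu sigma V p = 0)
  (* (i) *)
  (hmuL : locally_lipschitz mu) (hsigmaL : locally_lipschitz sigma)
  (hmu : piecewise_C 2 mu) (hsigma : piecewise_C 3 sigma)
  (hsigma0 : forall x, 0 < sigma x)
  (* (ii) *)
  (hG : usc_on (strip T) G)
  (* (iii) *)
  (hVcont : {within [set p : R * R | 0 < p.1 < T], continuous V})
  (* (iv) *)
  (hC : continuation_set T G V =
          [set p : R * R | 0 <= p.1 < T /\ b p.1 < p.2])
  (hD : stopping_set T G V =
          [set p : R * R | 0 <= p.1 < T /\ p.2 <= b p.1]
            `|` [set p : R * R | p.1 = T])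
  (* The sets above do not involve b T: convention b(T) = b(T-) whenever this
     left limit exists. *)
  (hbT : forall l, b t @[t --> T^'-] --> l -> b T = l)
  (* (v) and (vi); derivatives in the interior, see C12, and H_x >= ell wherever
     H_x exists (mu, sigma may have corners); on the closure H_x stands for its
     limit values, for which the bound is the same. *)
  (hG' : forall t, 0 <= t < T -> exists2 e, 0 < e &
     let A := disc (t, b t) e `&` continuation_set T G V in
     let H := fun p => dt G p + generator mu sigma G p in
     [/\ C12_closure A G,
         forall p, A° p ->
           [/\ derivable_x (dt G) p, {for p, continuous (dx (dt G))},
               derivable_x (dx (dx G)) p
             & {for p, continuous (dx (dx (dx G)))}],
         exists2 ell, 0 < ell &
           forall p, A° p -> derivable_x H p -> ell <= dx H p
       & forall p, A° p -> dx G p <= dx V p])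
  (t1 t2 : R) (ht1 : 0 <= t1) (ht12 : t1 <= t2) (ht2 : t2 <= T)
  (hb : forall s t, t1 <= s -> s <= t -> t <= t2 -> b t <= b s) :
  {within `[t1, t2], continuous b}.
Proof.
have cmu := locally_lipschitz_continuous hmuL.
have csigma := locally_lipschitz_continuous hsigmaL.
have onD t y : 0 <= t < T -> y <= b t -> V (t, y) = G (t, y).
  move=> tT yb; have : stopping_set T G V (t, y) by rewrite hD; left.
  by case.
have right_cont t eps : t1 <= t -> t < t2 -> 0 < eps ->
    exists2 del, 0 < del & forall s, t < s < t + del -> s <= t2 -> b t - eps < b s.
  move=> t1t tt2 eps0; apply: contrapT => nex.
  (* By monotonicity a single later time with [b s > b t - eps] would give a whole right
     neighbourhood, so failure of continuity is a jump seen at every later time. *)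
  have jump s : t < s -> s <= t2 -> b s <= b t - eps.
    move=> ts st2; rewrite leNgt; apply/negP => bs; apply: nex.
    exists (s - t); first by rewrite subr_gt0.
    move=> r /andP[tr rs] _; apply: (lt_le_trans bs); apply: hb => //.
      by rewrite (le_trans t1t)// ltW.
    by move: rs; rewrite addrC subrK => /ltW.
  have t0 : 0 <= t by exact: le_trans t1t.
  have tT : t < T by exact: lt_le_trans ht2.
  have tI : 0 <= t < T by rewrite t0.
  have [e e0 [GC G3 Hell uxge]] := hG' t tI.
  have d00 : 0 < t2 - t by rewrite subr_gt0.
  have bj s : t < s < t + (t2 - t) -> s < T /\ b s <= b t - eps.
    rewrite addrC subrK => /andP[ts st2]; split; first exact: lt_le_trans ht2.
    by apply: jump => //; exact: ltW.
  have [yb [xr [c [d' [c0 d'0 ybxr xrb gap]]]]] := right_jump_gap hVC12 hVpde cmu csigma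
    hmu hsigma hC t0 e0 eps0 d00 bj GC G3 Hell uxge.
  set A := disc (t, b t) e `&` continuation_set T G V in GC gap.
  have [_ Gcont _] := GC.
  (* At time [t] the segment lies in the stopping set, hence outside [A]; it is reached as a limit
     of later times. *)
  have clA s y : t <= s < t + d' -> yb <= y < xr -> closure A (s, y).
    move=> /andP[ts sd] yI; have [->{ts sd}|tns] := eqVneq s t; last first.
      apply: subset_closure; have [] := gap s y _ yI => //.
      by rewrite lt_neqAle eq_sym tns ts.
    move=> U /nbhs_planeP[r r0 hr].
    pose r' := Num.min r d' / 2.
    have mn0 : 0 < Num.min r d' by rewrite lt_min r0.
    have [r'0 r'r r'd] : [/\ 0 < r', r' < r & r' < d'].
      have h1 : Num.min r d' <= r by rewrite ge_min lexx.
      have h2 : Num.min r d' <= d' by rewrite ge_min lexx orbT.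
      by rewrite /r'; clear -mn0 h1 h2; split; lra.
    exists (t + r', y); split.
      by have [] := gap (t + r') y _ yI => //; rewrite ltrDl r'0 ltrD2l.
    by apply: hr; rewrite /= ?subrr ?normr0// addrAC subrr add0r gtr0_norm.
  have ybI : yb <= yb < xr by rewrite lexx.
  have clt y : yb <= y < xr -> closure A (t, y).
    by apply: clA; rewrite lexx ltrDl.
  have [tpos|] := ltP 0 t.
    (* [V] and [G] agree at [(t, yb)]; shortly afterwards each has moved by less than [c / 2], so
       they cannot differ by [c]. *)
    have c20 : 0 < c / 2 by rewrite divr_gt0.
    have pt : [set p : R * R | 0 < p.1 < T] (t, yb) by rewrite /= tpos.
    have [dV dV0 hdV] := within_planeP hVcont pt c20.
    have [dG dG0 hdG] := within_planeP Gcont (clt yb ybI) c20.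
    pose m := Num.min (Num.min dV dG) (Num.min d' (T - t)).
    have m0 : 0 < m by rewrite /m !lt_min dV0 dG0 d'0 subr_gt0.
    have h1 : m <= dV by rewrite /m !ge_min lexx.
    have h2 : m <= dG by rewrite /m !ge_min lexx orbT.
    have h3 : m <= d' by rewrite /m !ge_min lexx !orbT.
    have h4 : m <= T - t by rewrite /m !ge_min lexx !orbT.
    have [s1 s2 s3 s4] : [/\ t < t + m / 2, t + m / 2 < t + d', t + m / 2 < T & m / 2 < m].
      by clear -m0 h3 h4; split; lra.
    have sn : `|t + m / 2 - t| = m / 2.
      by rewrite addrAC subrr add0r gtr0_norm// divr_gt0.
    have sI : t < t + m / 2 < t + d' by rewrite s1.
    have [As gs] := gap (t + m / 2) yb sI ybI.
    have v1 : `|V (t + m / 2, yb) - V (t, yb)| < c / 2.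
      apply: hdV; rewrite /= ?s3 ?(lt_trans tpos)// ?subrr ?normr0// sn.
      exact: lt_le_trans h1.
    have v2 : `|G (t + m / 2, yb) - G (t, yb)| < c / 2.
      apply: hdG; [exact: subset_closure| |by rewrite /= subrr normr0].
      by rewrite /= sn; exact: lt_le_trans h2.
    have E := onD t yb tI (le_trans (ltW ybxr) xrb).
    by move: v1 v2; rewrite E !ltr_norml; clear -gs; lra.
  move=> tle0; have t_0 : t = 0 by apply/eqP; rewrite eq_le tle0.
  subst t.
  pose x := (yb + xr) / 2.
  have [ybx xxr] : yb < x /\ x < xr by rewrite /x; clear -ybxr; split; lra.
  pose eta := Num.min d' (Num.min (x - yb) (xr - x)).
  have eta0 : 0 < eta by rewrite /eta !lt_min d'0 !subr_gt0 ybx.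
  have e1 : eta <= d' by rewrite /eta !ge_min lexx.
  have e2 : eta <= x - yb by rewrite /eta !ge_min lexx !orbT.
  have e3 : eta <= xr - x by rewrite /eta !ge_min lexx !orbT.
  have yIn y : `|y - x| < eta -> yb <= y < xr.
    by rewrite ltr_norml; clear -e2 e3; lra.
  apply: (time_zero_no_gap hP hB hSDE hX cmu csigma hT hG hV htau hDclosed
    (x := x) c0 eta0).
  - move=> s y /andP[s0 se] /yIn yI.
    by have [] := gap s y _ yI => //; rewrite s0 add0r (lt_le_trans se).
  - by apply: onD => //; exact: le_trans (ltW xxr) xrb.
  - move=> eg eg0.
    have xI : yb <= x < xr by rewrite ltW.
    have [dG dG0 hdG] := within_planeP Gcont (clt x xI) eg0.
    exists (Num.min dG eta); first by rewrite lt_min dG0.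
    have m1 : Num.min dG eta <= dG by rewrite ge_min lexx.
    have m2 : Num.min dG eta <= eta by rewrite ge_min lexx orbT.
    move=> s y /andP[s0 sm] ym.
    have yI := yIn y (lt_le_trans ym m2).
    apply: hdG => /=.
    + apply: clA => //; rewrite s0 add0r.
      exact: lt_le_trans sm (le_trans m2 e1).
    + by rewrite subr0 ger0_norm//; exact: lt_le_trans m1.
    + exact: lt_le_trans m1.
have left_cont t eps : t1 < t -> t <= t2 -> 0 < eps ->
    exists2 del, 0 < del & forall s, t - del < s < t -> t1 <= s -> b s < b t + eps.
  move=> t1t tt2 eps0.
  have t0 : 0 < t by exact: le_lt_trans t1t.
  have [tT|Tt] := ltP t T.
    (* The point just above the boundary at time [t] is in the open continuation set, hence so is
       the same height at slightly earlier times. *)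
    have [U oU CU] := hCopen.
    have : continuation_set T G V (t, b t + eps).
      by rewrite hC /= tT ltW// ltrDl.
    rewrite CU => -[Ut _].
    have /nbhs_planeP[r r0 hr] : nbhs (t, b t + eps) U by exact: open_nbhs_nbhs.
    exists r => // s /andP[ts st] t1s.
    have : continuation_set T G V (s, b t + eps).
      rewrite CU; split.
        apply: hr; rewrite /= ?subrr ?normr0// distrC gtr0_norm ?subr_gt0//.
        by clear -ts; lra.
      by rewrite /strip/= (le_trans ht1)//= (ltW (lt_trans st tT)).
    by rewrite hC => -[].
  have tE : t = T by apply/eqP; rewrite eq_le Tt (le_trans tt2).
  subst t; have t2E : t2 = T by apply/eqP; rewrite eq_le ht2.
  subst t2.
  (* At [T] the sets carry no information on [b]; by monotonicity the left limit is this infimum,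
     and [hbT] identifies it with [b T]. *)
  pose I := b @` [set s | t1 <= s < T].
  have infI : has_inf I.
    split; first by exists (b t1), t1 => //=; rewrite lexx.
    by exists (b T) => _ [s /andP[t1s sT] <-]; apply: hb => //; exact: ltW.
  have small e : 0 < e -> exists2 s0, t1 <= s0 < T & b s0 < inf I + e.
    by move=> e0; have [_ [s0 s0I <-] h] := inf_adherent e0 infI; exists s0.
  have bT : b T = inf I.
    apply: hbT; apply/cvgrPdist_lt => e e0.
    have [s0 /andP[t1s0 s0T] hs0] := small e e0.
    near=> s.
    have s0s : s0 < s by near: s; exact: nbhs_left_gt.
    have sT : s < T by near: s; exact: nbhs_left_lt.
    have t1s : t1 <= s by rewrite (le_trans t1s0)// ltW.
    have bs : b s <= b s0 by apply: hb => //; exact: ltW.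
    have bi : inf I <= b s.
      by apply: ge_inf; [case: infI|exists s => //=; rewrite t1s].
    by rewrite ler0_norm ?subr_le0// opprB ltrBlDl (le_lt_trans bs).
  have [s0 /andP[t1s0 s0T] hs0] := small eps eps0.
  exists (T - s0); first by rewrite subr_gt0.
  move=> s /andP[s0s sT] t1s; rewrite bT; apply: le_lt_trans hs0.
  by apply: hb => //; [move: s0s; rewrite subKr => /ltW|exact: ltW].
apply/subspace_continuousP => t /=; rewrite in_itv/= => /andP[t1t tt2].
apply/cvgrPdist_lt => eps eps0.
(* At an endpoint of [[t1, t2]] the condition on the outer side is vacuous, and the radius [1] is
   arbitrary. *)
have [dR dR0 hR] : exists2 del, 0 < del &
    forall s, t < s < t + del -> s <= t2 -> b t - eps < b s.
  have [tlt|tge] := ltP t t2; first exact: right_cont.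
  by exists 1 => // s /andP[ts _] st2; have := lt_le_trans ts st2; rewrite ltNge tge.
have [dL dL0 hL] : exists2 del, 0 < del &
    forall s, t - del < s < t -> t1 <= s -> b s < b t + eps.
  have [tlt|tge] := ltP t1 t; first exact: left_cont.
  by exists 1 => // s /andP[_ ts] t1s; have := le_lt_trans t1s ts; rewrite ltNge tge.
apply/nbhs_ballP; exists (Num.min dR dL); first by rewrite /= lt_min dR0.
move=> s; rewrite /ball/= lt_min !ltr_norml => /andP[/andP[a1 a2] /andP[a3 a4]].
rewrite in_itv/= => /andP[t1s st2].
change (- eps < b t - b s < eps).
have [st|ts|->] := ltgtP s t; last by rewrite subrr oppr_lt0 eps0.
  have h1 : b s < b t + eps by apply: hL => //; clear -a4 st; lra.
  have h2 : b t <= b s by apply: hb => //; exact: ltW.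
  by clear -h1 h2 eps0; lra.
have h1 : b t - eps < b s by apply: hR => //; clear -a1 ts; lra.
have h2 : b s <= b t by apply: hb => //; exact: ltW.
by clear -h1 h2 eps0; lra.
Unshelve. all: by end_near. Qed.
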